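(* If there is a polynomial time $f$-approximation algorithm for $k$-Vertex Separator, then there is a polynomial time $2f^2$-approximation algorithm for Densest $k$-Subgraph.
   Context: $k$-Vertex Separator: given an undirected graph $G=(V,E)$ and $k\in\mathbb{N}$, find $S\subseteq V$ of minimum size such that every connected component of the induced subgraph $G|_{V\setminus S}$ has at most $k$ vertices; an $f$-approximation algorithm outputs such an $S$ (every component of size at most $k$) with $|S|$ at most $f$ times the minimum. Densest $k$-Subgraph: given an undirected graph $G=(V,E)$ and an integer $k$, find $S\subseteq V$ with $|S|=k$ maximizing the number of edges of the induced subgraph $G|_S$; a $g$-approximation algorithm outputs such an $S$ whose number of induced edges is at least a $1/g$ fraction of the maximum. Polynomial time means polynomial in the input size (graph size and $k$). *)

(* Defs.v *)
From mathcomp Require Import all_boot all_order all_algebra reals.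

Set Implicit Arguments.
Unset Strict Implicit.
Unset Printing Implicit Defensive.

Import Order.TTheory GRing.Theory Num.Theory.

Record sgraph := SGraph {
  order : nat;
  adj : rel 'I_order;
  adj_sym : symmetric adj;
  adj_irr : irreflexive adj
}.

Definition vertex (G : sgraph) : finType := 'I_(order G).

Definition induced (G : sgraph) (A : {set vertex G}) : rel (vertex G) :=
  [rel x y | [&& x \in A, y \in A & adj x y]].

Definition component (G : sgraph) (A : {set vertex G}) (x : vertex G) :
    {set vertex G} :=
  [set y in A | connect (induced A) x y].

Definition is_separator (G : sgraph) (k : nat) (S : {set vertex G}) : bool :=
  [forall x in ~: S, #|component (~: S) x| <= k].

(* The minimum is well defined: the whole vertex set is always a separator. *)
Definition min_separator (G : sgraph) (k : nat) : nat :=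
  #|[arg min_(S < [set: vertex G] | is_separator k S) #|S|]|.

(* Each edge is counted once, as the pair of its endpoints in increasing
   order. *)
Definition nb_edges (G : sgraph) (S : {set vertex G}) : nat :=
  #|[set p : vertex G * vertex G |
      [&& (p.1 < p.2)%N, p.1 \in S, p.2 \in S & adj p.1 p.2]]|.

Definition max_edges (G : sgraph) (k : nat) : nat :=
  \max_(S : {set vertex G} | #|S| == k) nb_edges S.

Definition approx_separator (R : realType) (f : R) (G : sgraph) (k : nat)
    (S : {set vertex G}) : Prop :=
  is_separator k S /\ (#|S|%:R <= f * (min_separator G k)%:R)%R.

Definition approx_densest (R : realType) (g : R) (G : sgraph) (k : nat)
    (S : {set vertex G}) : Prop :=
  #|S| = k /\ (g^-1 * (max_edges G k)%:R <= (nb_edges S)%:R)%R.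

(* The model of computation is the WHILE language of N. D. Jones,
   "Computability and Complexity from a Programming Perspective" (MIT Press,
   1997): imperative programs over binary trees, with every elementary
   operation at unit cost.  The functions with polynomially long output that it
   computes in polynomial time are those computed in polynomial time by Turing
   machines.  Unit cost is realistic although [Cons] duplicates its arguments:
   an implementation shares subtrees, so that a tree is a pointer, and the only
   test is whether a tree is a leaf. *)

Inductive tree := Leaf | Node of tree & tree.

Fixpoint tree_size (t : tree) : nat :=
  if t is Node l r then (tree_size l + tree_size r).+1 else 1.

Inductive expr :=
  | Var of nat
  | Nil
  | Cons of expr & expr
  | Hd of expr
  | Tl of expr.

Inductive cmd :=
  | Skip
  | Assign of nat & expr
  | Seq of cmd & cmd
  | If of expr & cmd & cmd
  | While of expr & cmd.

Definition store := nat -> tree.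

Definition update (s : store) (x : nat) (v : tree) : store :=
  fun y => if y == x then v else s y.

Definition is_node (t : tree) : bool := if t is Node _ _ then true else false.

Fixpoint eval (s : store) (e : expr) : tree :=
  match e with
  | Var x => s x
  | Nil => Leaf
  | Cons e1 e2 => Node (eval s e1) (eval s e2)
  | Hd e1 => if eval s e1 is Node l _ then l else Leaf
  | Tl e1 => if eval s e1 is Node _ r then r else Leaf
  end.

Fixpoint cost (e : expr) : nat :=
  match e with
  | Var _ | Nil => 1
  | Cons e1 e2 => (cost e1 + cost e2).+1
  | Hd e1 | Tl e1 => (cost e1).+1
  end.

(* [exec c s t s']: started in [s], [c] halts in [s'] after exactly [t] steps.
   A tree is true when it is not a leaf. *)
Inductive exec : cmd -> store -> nat -> store -> Prop :=
  | ExecSkip s : exec Skip s 1 s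
  | ExecAssign s x e :
      exec (Assign x e) s (cost e).+1 (update s x (eval s e))
  | ExecSeq c1 c2 s s1 s2 t1 t2 :
      exec c1 s t1 s1 -> exec c2 s1 t2 s2 ->
      exec (Seq c1 c2) s (t1 + t2).+1 s2
  | ExecIfTrue e c1 c2 s s1 t :
      is_node (eval s e) -> exec c1 s t s1 ->
      exec (If e c1 c2) s (cost e + t).+1 s1
  | ExecIfFalse e c1 c2 s s1 t :
      ~~ is_node (eval s e) -> exec c2 s t s1 ->
      exec (If e c1 c2) s (cost e + t).+1 s1
  | ExecWhileTrue e c s s1 s2 t1 t2 :
      is_node (eval s e) -> exec c s t1 s1 -> exec (While e c) s1 t2 s2 ->
      exec (While e c) s (cost e + t1 + t2).+1 s2
  | ExecWhileFalse e c s :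
      ~~ is_node (eval s e) -> exec (While e c) s (cost e).+1 s.

Definition init_store (v : tree) : store := update (fun=> Leaf) 0 v.

(* The input is read from, and the output left in, variable 0. *)
Definition runs (c : cmd) (input : tree) (t : nat) (output : tree) : Prop :=
  exists2 s, exec c (init_store input) t s & s 0 = output.

(* Graphs are given by their adjacency matrix, sets by their characteristic
   vector, and [k] in unary, so that an instance with [n] vertices has size
   of the order of [n ^ 2 + k]. *)

Definition enc_nat (n : nat) : tree := iter n (Node Leaf) Leaf.

Definition enc_bool (b : bool) : tree := if b then Node Leaf Leaf else Leaf.

Definition enc_seq (s : seq tree) : tree := foldr Node Leaf s.

Definition enc_graph (G : sgraph) : tree :=
  enc_seq [seq enc_seq [seq enc_bool (adj x y) | y <- enum 'I_(order G)]
          | x <- enum 'I_(order G)].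

Definition enc_instance (G : sgraph) (k : nat) : tree :=
  Node (enc_graph G) (enc_nat k).

Definition enc_set (G : sgraph) (S : {set vertex G}) : tree :=
  enc_seq [seq enc_bool (x \in S) | x <- enum 'I_(order G)].

(* [dom] selects the legal instances; nothing is asked on the others. *)
Definition poly_time_algorithm (dom : sgraph -> nat -> Prop)
    (sol : forall (G : sgraph) (k : nat), {set vertex G} -> Prop) (c : cmd) :
    Prop :=
  exists a d : nat, forall (G : sgraph) (k : nat), dom G k ->
    exists (t : nat) (S : {set vertex G}),
      [/\ runs c (enc_instance G k) t (enc_set S),
          t <= a * tree_size (enc_instance G k) ^ d + a
        & sol G k S].

Definition separator_approx_algorithm (R : realType) (f : R) (c : cmd) : Prop :=
  poly_time_algorithm (fun _ _ => True) (@approx_separator R f) c.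

(* A set of [k] vertices exists only when [k] is at most the number of
   vertices. *)
Definition densest_approx_algorithm (R : realType) (g : R) (c : cmd) : Prop :=
  poly_time_algorithm (fun G k => k <= order G) (@approx_densest R g) c.

(* Main.v *)
Require Import Defs.
From mathcomp Require Import all_boot all_order all_algebra reals.
From mathcomp Require Import boolp zify ring lra.

(* Replace a graph with n vertices by the gadget made of a clique on its
   vertices and of n + 2 copies of each ordered pair of vertices, where the
   copies of an edge are joined to its two endpoints and the other copies are
   isolated.  Removing a set T of vertices leaves a big component that contains
   n - |T| vertices and the copies of the edges that T does not induce.  If T
   is a densest set of k vertices and K is the size of that component plus one,
   an f-approximate K-separator has at most f k elements.  Trade each copy in it
   for a vertex, which shrinks the big component at least as much, and add
   vertices up to k: since there are more than n + 1 copies, the resulting set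
   induces as many edges as T.  Trimming it greedily to k vertices keeps a
   fraction k (k - 1) / (f k (f k - 1)) >= 1 / (2 f ^ 2) of these edges.  As K is
   not known, all values are tried.

   Polynomial time is proved compositionally: the functions computed by WHILE
   programs with polynomially bounded time and output are closed under pairing,
   tests, folds with polynomially bounded accumulators, and calls to a given
   program. *)

Set Implicit Arguments.
Unset Strict Implicit.
Unset Printing Implicit Defensive.

Import Order.TTheory GRing.Theory Num.Theory.

(** * Polynomial time *)

(** The base is at least 2, so constants and sums are absorbed by raising the exponent, and
    polynomials need no coefficients. *)
Definition pbound X (i : X -> tree) (g : X -> nat) : Prop :=
  exists d, forall x, g x <= (tree_size (i x)).+2 ^ d.

Section Bounds.
Variables (X : Type) (i : X -> tree).
Implicit Types g h : X -> nat.

Lemma pbound_le g h : (forall x, g x <= h x) -> pbound i h -> pbound i g.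
Proof. by move=> gh [d hd]; exists d => x; apply: leq_trans (gh x) (hd x). Qed.

Lemma pbound_const n : pbound i (fun=> n).
Proof.
exists n => x; apply: leq_trans (ltnW (ltn_expl n (ltnSn 1))) _.
by case: n => // n; rewrite leq_exp2r.
Qed.

Lemma pbound_size : pbound i (fun x => tree_size (i x)).
Proof. by exists 1 => x; rewrite expn1; lia. Qed.

Lemma pbound_mul g h :
  pbound i g -> pbound i h -> pbound i (fun x => g x * h x).
Proof.
by move=> [d gd] [e he]; exists (d + e) => x; rewrite expnD leq_mul.
Qed.

Lemma pbound_add g h :
  pbound i g -> pbound i h -> pbound i (fun x => g x + h x).
Proof.
move=> [d gd] [e he]; exists (d + e).+1 => x.
set n := (tree_size (i x)).+2.
have pn m : 0 < n ^ m by rewrite expn_gt0.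
have gx : g x <= n ^ (d + e) by rewrite expnD (leq_trans (gd x)) // leq_pmulr.
have hx : h x <= n ^ (d + e) by rewrite expnD (leq_trans (he x)) // leq_pmull.
rewrite expnS (leq_trans (leq_add gx hx)) // addnn -mul2n leq_mul2r.
by rewrite orbC.
Qed.

Lemma pbound_exp g d : pbound i g -> pbound i (fun x => g x ^ d).
Proof.
move=> gb; elim: d => [|d IH]; first exact: pbound_const 1.
by apply: pbound_le (pbound_mul gb IH) => x; rewrite expnS.
Qed.

End Bounds.

Lemma pbound_trans X (i j : X -> tree) g :
  pbound i (fun x => tree_size (j x)) -> pbound j g -> pbound i g.
Proof.
move=> ij [d gd]; apply: pbound_le gd _; apply: pbound_exp.
by apply: pbound_le (pbound_add ij (pbound_const _ 2)) => x; lia.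
Qed.

Lemma tree_size_gt0 t : 0 < tree_size t.
Proof. by case: t. Qed.

(* The index type [X] makes a family of inputs [i] the domain of a program, so
   partial functions such as an oracle on graphs are total here.  The size of
   the output has to be bounded besides the time, as [Cons] can double the size
   of a tree at unit cost. *)
Definition ptime X (i o : X -> tree) : Prop :=
  exists c B T,
    [/\ pbound i T, pbound i (fun x => tree_size (o x))
      & forall x s, s 0 = i x ->
        exists t s', [/\ exec c s t s', t <= T x, s' 0 = o x
                       & forall y, B <= y -> s' y = s y]].

Lemma update_eq s x v : update s x v x = v.
Proof. by rewrite /update eqxx. Qed.

Lemma update_neq s x v y : y != x -> update s x v y = s y.
Proof. by rewrite /update => /negPf->. Qed.

Ltac upd := rewrite /= ?(update_eq, update_neq) //; try lia.

(** * Closure under composition, pairing and tests *)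

Section Closure.
Variables (X : Type) (i : X -> tree).

Lemma ptime_ext o o' : (forall x, o x = o' x) -> ptime i o -> ptime i o'.
Proof.
move=> eqo [c [B [T [bT bo H]]]]; exists c, B, T; split=> //.
  by apply: pbound_le bo => x; rewrite eqo.
by move=> x s; rewrite -eqo; apply: H.
Qed.

Lemma ptime_expr e o :
  (forall x s, s 0 = i x -> eval s e = o x) ->
  pbound i (fun x => tree_size (o x)) -> ptime i o.
Proof.
move=> eo bo; exists (Assign 0 e), 1, (fun=> (cost e).+1); split=> //.
  exact: pbound_const.
move=> x s sx; exists (cost e).+1, (update s 0 (eval s e)).
by split=> [|//||y ?]; [exact: ExecAssign | rewrite update_eq; apply: eo | upd].
Qed.

Lemma ptime_id : ptime i i.
Proof. by apply: (@ptime_expr (Var 0)) => //; apply: pbound_size. Qed.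

Lemma ptime_leaf : ptime i (fun=> Leaf).
Proof. by apply: (@ptime_expr Defs.Nil) => //; apply: pbound_const. Qed.

Lemma ptime_trans o o' : ptime i o -> ptime o o' -> ptime i o'.
Proof.
move=> [c [B [T [bT bo H]]]] [c' [B' [T' [bT' bo' H']]]].
exists (Seq c c'), (maxn B B'), (fun x => (T x + T' x) + 1); split.
- apply: pbound_add (pbound_const _ _); apply: pbound_add => //.
  exact: pbound_trans bT'.
- exact: pbound_trans bo'.
move=> x s /H[t [s1 [e1 t1 o1 f1]]].
have [t' [s2 [e2 t2 o2 f2]]] := H' x s1 o1.
exists (t + t').+1, s2; split=> //; [exact: ExecSeq e1 e2 | lia |].
by move=> y yB; rewrite f2 ?f1 //; lia.
Qed.

Lemma ptime_cons a b :
  ptime i a -> ptime i b -> ptime i (fun x => Node (a x) (b x)).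
Proof.
move=> [c [B1 [T [bT bo H]]]] [c' [B' [T' [bT' bo' H']]]].
(* Register [B] keeps the input during the first run and [B.+1] the first result during the second;
   both programs leave registers from [B] on unchanged. The successor keeps [B] distinct from
   register 0. *)
pose B := (maxn B1 B').+1.
exists (Seq (Assign B (Var 0)) (Seq c (Seq (Assign B.+1 (Var 0))
  (Seq (Assign 0 (Var B)) (Seq c' (Assign 0 (Defs.Cons (Var B.+1) (Var 0)))))))).
exists B.+2, (fun x => T x + T' x + 15); split.
- by apply: pbound_add (pbound_const _ _); apply: pbound_add.
- apply: pbound_le (pbound_add (pbound_add bo bo') (pbound_const _ 1)) => x /=.
  lia.
move=> x s sx.
have [|t1 [s1 [e1 le1 o1 f1]]] := H x (update s B (s 0)); first by upd.
have [|t2 [s2 [e2 le2 o2 f2]]] :=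
  H' x (update (update s1 B.+1 (s1 0)) 0 (update s1 B.+1 (s1 0) B)).
  by upd; rewrite f1 ?update_eq // /B; lia.
eexists _, _; split.
- apply: ExecSeq; first exact: ExecAssign.
  apply: ExecSeq; first exact: e1.
  apply: ExecSeq; first exact: ExecAssign.
  apply: ExecSeq; first by apply: ExecAssign.
  by apply: ExecSeq; [exact: e2 | exact: ExecAssign].
- by rewrite /=; lia.
- upd; rewrite o2 f2; last by rewrite /B; lia.
  by upd; rewrite o1.
- move=> y yB; upd; rewrite f2; last by lia.
  by upd; rewrite f1; [upd | lia].
Qed.

Lemma ptime_if q a b :
  ptime i q -> ptime i a -> ptime i b ->
  ptime i (fun x => if is_node (q x) then a x else b x).
Proof.
move=> [c0 [B0 [T0 [bT0 bo0 H0]]]] [c [B1 [T [bT bo H]]]].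
move=> [c' [B' [T' [bT' bo' H']]]].
pose B := (maxn B0 (maxn B1 B')).+1.
exists (Seq (Assign B (Var 0)) (Seq c0 (Seq (Assign B.+1 (Var 0))
  (Seq (Assign 0 (Var B)) (If (Var B.+1) c c'))))).
exists B.+2, (fun x => T0 x + T x + T' x + 15); split.
- apply: pbound_add (pbound_const _ _); apply: pbound_add => //.
  exact: pbound_add.
- by apply: pbound_le (pbound_add bo bo') => x /=; case: ifP => _; lia.
move=> x s sx.
have [|t0 [s0 [e0 le0 o0 f0]]] := H0 x (update s B (s 0)); first by upd.
pose s1 := update (update s0 B.+1 (s0 0)) 0 (update s0 B.+1 (s0 0) B).
have s1x : s1 0 = i x by rewrite /s1; upd; rewrite f0 ?update_eq // /B; lia.
have s1B : eval s1 (Var B.+1) = q x by rewrite /s1; upd.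
have s1f y : B.+2 <= y -> s1 y = s y.
  by move=> yB; rewrite /s1; upd; rewrite f0; [upd | lia].
case: ifP => qx.
- have [t1 [s2 [e1 le1 o1 f1]]] := H x s1 s1x.
  eexists _, _; split.
  + apply: ExecSeq; first exact: ExecAssign.
    apply: ExecSeq; first exact: e0.
    apply: ExecSeq; first exact: ExecAssign.
    apply: ExecSeq; first by apply: ExecAssign.
    by apply: ExecIfTrue; [rewrite -/s1 s1B | exact: e1].
  + by rewrite /=; lia.
  + by [].
  + by move=> y yB; rewrite f1 ?s1f //; lia.
have [t1 [s2 [e1 le1 o1 f1]]] := H' x s1 s1x.
eexists _, _; split.
+ apply: ExecSeq; first exact: ExecAssign.
  apply: ExecSeq; first exact: e0.
  apply: ExecSeq; first exact: ExecAssign.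
  apply: ExecSeq; first by apply: ExecAssign.
  by apply: ExecIfFalse; [rewrite -/s1 s1B qx | exact: e1].
+ by rewrite /=; lia.
+ by [].
+ by move=> y yB; rewrite f1 ?s1f //; lia.
Qed.

End Closure.

Definition child (b : bool) (v : tree) : tree :=
  if v is Node l r then if b then r else l else Leaf.

Definition subtree_at (p : seq bool) (v : tree) : tree :=
  foldl (fun v b => child b v) v p.

Lemma ptime_path X (i o : X -> tree) p :
  (forall x, subtree_at p (i x) = o x) -> ptime i o.
Proof.
move=> io; apply: (ptime_ext io); elim/last_ind: p {io} => [|p b IH].
  exact: ptime_id.
have sz v : tree_size (child b v) <= tree_size v.
  by case: v b => [|l r] [] //=; lia.
apply: ptime_trans IH _.
apply: (@ptime_expr _ _ (if b then Tl (Var 0) else Hd (Var 0))) => [x s|].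
  by rewrite /subtree_at foldl_rcons => <-; case: b {sz}; rewrite /=; case: (s 0).
apply: pbound_le (pbound_size _) => x.
by rewrite /subtree_at foldl_rcons.
Qed.

(** Reindexing: one program serves the whole family [j], hence also its members selected by [h]. A
    subprogram can thus be used inside a loop, whose index type is larger. *)
Lemma ptime_comp X Y (i : X -> tree) (j o : Y -> tree) (h : X -> Y) :
  ptime j o -> ptime i (fun x => j (h x)) -> ptime i (fun x => o (h x)).
Proof.
move=> [c [B [T [[d bT] [e bo] H]]]] ij; apply: ptime_trans ij _.
exists c, B, (fun x => T (h x)); split; [by exists d | by exists e |].
by move=> x s /H.
Qed.

(** * Lists *)

Definition enc_list A (e : A -> tree) (l : seq A) : tree :=
  enc_seq [seq e x | x <- l].

Lemma enc_list_sizeE A (e : A -> tree) l :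
  tree_size (enc_list e l) = (\sum_(x <- l) (tree_size (e x)).+1).+1.
Proof.
elim: l => [|x l /= ->]; first by rewrite big_nil.
by rewrite big_cons; lia.
Qed.

Lemma enc_list_size_le A (e : A -> tree) l m :
  (forall x, List.In x l -> tree_size (e x) <= m) ->
  tree_size (enc_list e l) <= size l * m.+1 + 1.
Proof.
elim: l => [//|x l IH] H /=.
have := H x (or_introl erefl).
by have /IH : forall y, List.In y l -> tree_size (e y) <= m
  by [move=> y yl; apply: H; right]; rewrite /enc_list; lia.
Qed.

Lemma enc_list_size_in A (e : A -> tree) l x :
  List.In x l -> tree_size (e x) < tree_size (enc_list e l).
Proof. by elim: l => [//|y l IH] /= [->|/IH]; rewrite /enc_list /=; lia. Qed.

Lemma enc_list_size_length A (e : A -> tree) l :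
  size l < tree_size (enc_list e l).
Proof.
elim: l => [//|x l IH] /=; have := tree_size_gt0 (e x).
by move: IH; rewrite /enc_list; lia.
Qed.

(** Register [B.+1] holds the input, [B.+2] the part of the list still to be read, and [B.+3] the
    accumulator. *)
Definition fold_body (cs : cmd) (B : nat) : cmd :=
  Seq (Assign 0 (Defs.Cons (Var B.+1) (Defs.Cons (Var B.+3) (Hd (Var B.+2)))))
    (Seq cs (Seq (Assign B.+3 (Var 0)) (Assign B.+2 (Tl (Var B.+2))))).

Section Fold.
Variables (X A E : Type) (i : X -> tree) (eA : A -> tree) (eE : E -> tree).
Variables (l : X -> seq E) (a : X -> A).

Section Loop.
Variables (f : A -> E -> A) (u : tree) (cs : cmd) (B Q : nat).
Variable good : A -> E -> Prop.
Hypothesis step : forall a e s, good a e -> s 0 = Node u (Node (eA a) (eE e)) ->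
  exists t s', [/\ exec cs s t s', t <= Q, s' 0 = eA (f a e)
                 & forall y, B < y -> s' y = s y].

(** [good] marks the accumulators and elements that the run meets; for these the size bounds will
    yield the uniform time bound [Q] on the body. *)
Lemma loop_exec l0 a0 s :
  (forall l1 e l2, l0 = l1 ++ e :: l2 -> good (foldl f a0 l1) e) ->
  s B.+1 = u -> s B.+2 = enc_list eE l0 -> s B.+3 = eA a0 ->
  exists t s', [/\ exec (While (Var B.+2) (fold_body cs B)) s t s',
    t <= size l0 * (Q + 30) + 2, s' B.+3 = eA (foldl f a0 l0)
    & forall y, B.+3 < y -> s' y = s y].
Proof.
elim: l0 a0 s => [|e l0 IH] a0 s good0 su sl sa.
  exists 2, s; split=> //; apply: ExecWhileFalse.
  by rewrite /= sl.
have [|t1 [s1 [e1 le1 o1 f1]]] := @step a0 e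
  (update s 0 (Node u (Node (eA a0) (eE e)))) (good0 [::] e l0 erefl); first by upd.
pose s2 := update (update s1 B.+3 (s1 0)) B.+2 (enc_list eE l0).
have [l1 e' l2 l0E||||t2 [s3 [e3 le3 o3 f3]]] := IH (f a0 e) s2.
- by apply: (good0 (e :: l1) e' l2); rewrite l0E.
- by rewrite /s2; upd; rewrite f1; [upd | lia].
- by rewrite /s2; upd.
- by rewrite /s2; upd.
eexists _, s3; split.
- apply: ExecWhileTrue; first by rewrite /= sl.
    apply: ExecSeq; first exact: ExecAssign.
    rewrite /= su sa sl /=.
    apply: ExecSeq; first exact: e1.
    apply: ExecSeq; first exact: ExecAssign.
    exact: ExecAssign.
  rewrite /= (_ : update s1 B.+3 (s1 0) B.+2 = enc_list eE (e :: l0)) //.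
    exact: e3.
  by upd; rewrite f1 ?update_neq; try lia; rewrite sl.
- by rewrite /=; lia.
- by [].
- move=> y yB; rewrite f3 // /s2; upd.
  by rewrite f1; [upd | lia].
Qed.

End Loop.

(** A polynomial-time body may double its accumulator in every round, so the last hypothesis bounds
    the accumulators reached after all prefixes. This bounds each round, and there are fewer rounds
    than the size of the encoded list. *)
Lemma ptime_foldl (f : X -> A -> E -> A) :
  ptime i (fun x => enc_list eE (l x)) -> ptime i (fun x => eA (a x)) ->
  ptime (fun z : X * A * E => Node (i z.1.1) (Node (eA z.1.2) (eE z.2)))
        (fun z => eA (f z.1.1 z.1.2 z.2)) ->
  (exists2 g, pbound i g & forall x l1 l2, l x = l1 ++ l2 ->
     tree_size (eA (foldl (f x) (a x) l1)) <= g x) ->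
  ptime i (fun x => eA (foldl (f x) (a x) (l x))).
Proof.
move=> [cl [Bl [Tm [bTl bl Hl]]]] [ca [Ba [Ta [bTa ba Ha]]]].
move=> [cs [Bs [Ts [[d bTs] _ Hs]]]] [g bg Hg].
pose B := maxn Bl (maxn Ba Bs).
have [BlB BaB BsB] : [/\ Bl <= B, Ba <= B & Bs <= B] by rewrite /B; split; lia.
clearbody B.
(* The body reads an input, an accumulator and an element joined by two nodes, and [pbound] adds 2
   to the size: whence the 4. *)
pose Q x := (tree_size (i x) + (g x + tree_size (enc_list eE (l x))) + 4) ^ d.
exists (Seq (Assign B.+1 (Var 0)) (Seq cl (Seq (Assign B.+2 (Var 0))
  (Seq (Assign 0 (Var B.+1)) (Seq ca (Seq (Assign B.+3 (Var 0))
  (Seq (While (Var B.+2) (fold_body cs B)) (Assign 0 (Var B.+3))))))))).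
exists B.+4, (fun x => Tm x + Ta x +
  (tree_size (enc_list eE (l x)) * (Q x + 30)) + 30); split.
- apply: pbound_add (pbound_const _ _); do 2?apply: pbound_add => //.
  apply: pbound_mul => //; apply: pbound_add (pbound_const _ _).
  apply: pbound_exp; apply: pbound_add (pbound_const _ _).
  by apply: pbound_add; [exact: pbound_size | exact: pbound_add].
- apply: pbound_le bg => x.
  by apply: (Hg x (l x) [::]); rewrite cats0.
move=> x s sx.
have [|t1 [s1 [e1 le1 o1 f1]]] := Hl x (update s B.+1 (s 0)); first by upd.
have [|t2 [s2 [e2 le2 o2 f2]]] :=
  Ha x (update (update s1 B.+2 (s1 0)) 0 (update s1 B.+2 (s1 0) B.+1)).
  by upd; rewrite f1 ?update_eq //; lia.
pose good a0 e := (tree_size (eA a0) <= g x) /\ List.In e (l x).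
have step a0 e s0 : good a0 e -> s0 0 = Node (i x) (Node (eA a0) (eE e)) ->
  exists t s', [/\ exec cs s0 t s', t <= Q x, s' 0 = eA (f x a0 e)
                 & forall y, B < y -> s' y = s0 y].
  move=> [ga le] s0x.
  have [t [s' [es lt os fs]]] := Hs (x, a0, e) s0 s0x.
  exists t, s'; split=> //; last by move=> y yB; apply: fs; lia.
  apply: leq_trans lt (leq_trans (bTs _) _); rewrite /Q /=.
  have [->//|d_gt0] := posnP d; rewrite leq_exp2r //.
  by have := enc_list_size_in eE le; lia.
pose s3 := update s2 B.+3 (s2 0).
have [l1 e l2 lE|||| t3 [s4 [e4 le4 o4 f4]]] :=
  @loop_exec (f x) (i x) cs B (Q x) good step (l x) (a x) s3.
- split; first by apply: (Hg x l1 (e :: l2)).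
  by rewrite lE; apply/List.in_or_app; right; left.
- by rewrite /s3; upd; rewrite f2; [upd; rewrite f1; [upd|lia]|lia].
- by rewrite /s3; upd; rewrite f2; [upd | lia].
- by rewrite /s3; upd.
eexists _, _; split.
- apply: ExecSeq; first exact: ExecAssign.
  apply: ExecSeq; first exact: e1.
  apply: ExecSeq; first exact: ExecAssign.
  apply: ExecSeq; first by apply: ExecAssign.
  apply: ExecSeq; first exact: e2.
  apply: ExecSeq; first exact: ExecAssign.
  apply: ExecSeq; first exact: e4.
  exact: ExecAssign.
- rewrite /=; have := enc_list_size_length eE (l x).
  set m := tree_size (enc_list eE (l x)); set q := Q x + 30 in le4 *.
  move=> lm; have : size (l x) * q <= m * q by rewrite leq_mul2r ltnW ?orbT.
  by lia.
- by upd.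
- move=> y yB; upd; rewrite f4 // /s3; upd.
  rewrite f2; [upd | lia].
  by rewrite f1; [upd | lia].
Qed.

End Fold.

(** Searches the paths of length at most 5 for the component of an encoded tuple that is the wanted
    output. *)
Ltac try_path n p :=
  first [ solve [apply: (@ptime_path _ _ _ p); move=> ?; reflexivity]
        | lazymatch n with S ?m =>
            first [ try_path m constr:(rcons p false)
                  | try_path m constr:(rcons p true) ] end ].
Ltac pvar := try_path 5 (@nil bool).

(** * List operations as folds *)

Lemma ptime_rev X A (i : X -> tree) (e : A -> tree) l :
  ptime i (fun x => enc_list e (l x)) ->
  ptime i (fun x => enc_list e (rev (l x))).
Proof.
move=> pl; have revE s : foldl (fun a (y : A) => y :: a) [::] s = rev s.
  by rewrite /rev; move: [::]; elim: s => //= y s IH a; rewrite IH.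
apply: (ptime_ext (fun x => congr1 (enc_list e) (revE (l x)))).
apply: (@ptime_foldl _ _ _ i _ e l (fun=> [::]) (fun _ a y => y :: a)) => //.
- exact: ptime_leaf.
- by apply: ptime_cons; pvar.
case: pl => [c [B [T [_ bl _]]]]; exists (fun x => tree_size (enc_list e (l x))).
  exact: bl.
move=> x l1 l2 lE; rewrite revE lE !enc_list_sizeE big_cat /= ltnS.
apply: leq_trans (leq_addr _ _); elim: l1 {lE} => [|y l1 IH].
  by rewrite !big_nil.
by rewrite rev_cons -cats1 big_cat /= !big_cons big_nil; lia.
Qed.

(** A right fold is a left fold over the reversed list; accumulators are therefore bounded on
    suffixes. *)
Lemma ptime_foldr X A E (i : X -> tree) (eA : A -> tree) (eE : E -> tree)
    (l : X -> seq E) (a : X -> A) (f : X -> E -> A -> A) :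
  ptime i (fun x => enc_list eE (l x)) -> ptime i (fun x => eA (a x)) ->
  ptime (fun z : X * A * E => Node (i z.1.1) (Node (eA z.1.2) (eE z.2)))
        (fun z => eA (f z.1.1 z.2 z.1.2)) ->
  (exists2 g, pbound i g & forall x l1 l2, l x = l1 ++ l2 ->
     tree_size (eA (foldr (f x) (a x) l2)) <= g x) ->
  ptime i (fun x => eA (foldr (f x) (a x) (l x))).
Proof.
move=> pl pa pf [g bg Hg].
apply: (@ptime_ext _ _ (fun x =>
  eA (foldl (fun a y => f x y a) (a x) (rev (l x))))).
  by move=> x; rewrite foldl_rev.
apply: (@ptime_foldl _ _ _ i eA eE (fun x => rev (l x)) a
  (fun x a y => f x y a)) => //; first exact: ptime_rev.
exists g => // x l1 l2 lE.
rewrite -[l1]revK foldl_rev; apply: (Hg x (rev l2)).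
by rewrite -rev_cat -lE revK.
Qed.

Lemma ptime_bound X (i o : X -> tree) :
  ptime i o -> pbound i (fun x => tree_size (o x)).
Proof. by case=> c [B [T []]]. Qed.

Lemma ptime_cat X A (i : X -> tree) (e : A -> tree) l1 l2 :
  ptime i (fun x => enc_list e (l1 x)) -> ptime i (fun x => enc_list e (l2 x)) ->
  ptime i (fun x => enc_list e (l1 x ++ l2 x)).
Proof.
move=> p1 p2; have catE (s1 s2 : seq A) : foldr cons s2 s1 = s1 ++ s2.
  by elim: s1 => //= y s1 ->.
apply: (ptime_ext (fun x => congr1 (enc_list e) (catE (l1 x) (l2 x)))).
apply: (@ptime_foldr _ _ _ i _ e l1 l2 (fun=> cons)) => //.
  by apply: ptime_cons; pvar.
eexists; first exact: pbound_add (ptime_bound p1) (ptime_bound p2).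
move=> x s1 s2 l1E; rewrite catE l1E !enc_list_sizeE !big_cat /=; lia.
Qed.

Lemma ptime_map X A C (i : X -> tree) (eA : A -> tree) (eC : C -> tree)
    (l : X -> seq A) (g : X -> A -> C) :
  ptime i (fun x => enc_list eA (l x)) ->
  ptime (fun z : X * A => Node (i z.1) (eA z.2)) (fun z => eC (g z.1 z.2)) ->
  ptime i (fun x => enc_list eC [seq g x y | y <- l x]).
Proof.
move=> pl pg; have mapE x s : foldr (fun y a => g x y :: a) [::] s = map (g x) s.
  by elim: s => //= y s ->.
apply: (ptime_ext (fun x => congr1 (enc_list eC) (mapE x (l x)))).
apply: (@ptime_foldr _ _ _ i _ eA l (fun=> [::]) (fun x y a => g x y :: a)) => //.
- exact: ptime_leaf.
- apply: ptime_cons; last by pvar.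
  apply: (ptime_comp (h := fun z : X * seq C * A => (z.1.1, z.2)) pg).
  by apply: ptime_cons; pvar.
have bl := ptime_bound pl; have [d bg] := ptime_bound pg.
(* Each image has size at most the [d]-th power of this base; the extra factor pays for the node
   that holds the image in the list. *)
exists (fun x => tree_size (enc_list eA (l x)) *
  (tree_size (i x) + tree_size (enc_list eA (l x)) + 3) ^ d.+1 + 1).
  apply: pbound_add (pbound_const _ _); apply: pbound_mul => //.
  apply: pbound_exp; apply: pbound_add (pbound_const _ _).
  by apply: pbound_add => //; exact: pbound_size.
move=> x l1 l2 lE; rewrite mapE.
set m := tree_size (enc_list eA (l x)); set b := tree_size (i x) + m + 3.
have := @enc_list_size_le _ eC (map (g x) l2) (b ^ d).
rewrite size_map => H; apply: leq_trans (H _) _; last first.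
  rewrite leq_add2r; apply: leq_mul.
    apply: leq_trans (ltnW (enc_list_size_length eA (l x))).
    by rewrite lE size_cat leq_addl.
  rewrite expnS; have : 0 < b ^ d by rewrite expn_gt0 /b; lia.
  by rewrite /b; nia.
move=> y /List.in_map_iff[z [<- zl]]; apply: leq_trans (bg (x, z)) _ => /=.
have [->//|d_gt0] := posnP d; rewrite leq_exp2r //.
suff : tree_size (eA z) < m by rewrite /b; lia.
by apply: enc_list_size_in; rewrite lE; apply/List.in_or_app; right.
Qed.

Lemma ptime_flatten X A (i : X -> tree) (e : A -> tree) l :
  ptime i (fun x => enc_list (enc_list e) (l x)) ->
  ptime i (fun x => enc_list e (flatten (l x))).
Proof.
move=> pl.
apply: (@ptime_foldr _ _ _ i _ (enc_list e) l (fun=> [::]) (fun=> cat)) => //.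
- exact: ptime_leaf.
- by apply: ptime_cat; pvar.
exists (fun x => tree_size (enc_list (enc_list e) (l x))).
  exact: ptime_bound pl.
move=> x l1 l2 ->; rewrite -/(flatten l2).
rewrite [X in _ <= X]enc_list_sizeE big_cat /=.
suff : tree_size (enc_list e (flatten l2)) <=
    (\sum_(y <- l2) (tree_size (enc_list e y)).+1).+1 by lia.
rewrite enc_list_sizeE ltnS; elim: l2 => [|y l2 IH]; first by rewrite !big_nil.
by rewrite /= big_cat big_cons /= enc_list_sizeE; lia.
Qed.

Lemma ptime_ifb X (i a b : X -> tree) (q : X -> bool) :
  ptime i (fun x => enc_bool (q x)) -> ptime i a -> ptime i b ->
  ptime i (fun x => if q x then a x else b x).
Proof.
move=> pq pa pb; apply: ptime_ext (ptime_if pq pa pb) => x.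
by case: (q x).
Qed.

Lemma ptime_filter X A (i : X -> tree) (e : A -> tree) l (p : X -> pred A) :
  ptime i (fun x => enc_list e (l x)) ->
  ptime (fun z : X * A => Node (i z.1) (e z.2)) (fun z => enc_bool (p z.1 z.2)) ->
  ptime i (fun x => enc_list e [seq y <- l x | p x y]).
Proof.
move=> pl pp.
apply: (@ptime_ext _ _ (fun x =>
  enc_list e (flatten [seq if p x y then [:: y] else [::] | y <- l x]))).
  by move=> x; congr enc_list; elim: (l x) => //= y s ->; case: (p x y).
apply: ptime_flatten; apply: ptime_map pl _.
apply: (@ptime_ext _ _
  (fun z => if p z.1 z.2 then Node (e z.2) Leaf else Leaf)).
  by move=> z; case: ifP.
apply: ptime_ifb pp _ (ptime_leaf _); apply: ptime_cons (ptime_leaf _); pvar.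
Qed.

Lemma ptime_true X (i : X -> tree) : ptime i (fun=> enc_bool true).
Proof. exact: ptime_cons (ptime_leaf _) (ptime_leaf _). Qed.

Lemma ptime_andb X (i : X -> tree) p q :
  ptime i (fun x => enc_bool (p x)) -> ptime i (fun x => enc_bool (q x)) ->
  ptime i (fun x => enc_bool (p x && q x)).
Proof.
move=> pp pq; apply: ptime_ext (ptime_ifb pp pq (ptime_leaf _)) => x.
by case: (p x).
Qed.

Lemma ptime_orb X (i : X -> tree) p q :
  ptime i (fun x => enc_bool (p x)) -> ptime i (fun x => enc_bool (q x)) ->
  ptime i (fun x => enc_bool (p x || q x)).
Proof.
move=> pp pq; apply: ptime_ext (ptime_ifb pp (ptime_true _) pq) => x.
by case: (p x).
Qed.

Lemma ptime_negb X (i : X -> tree) p :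
  ptime i (fun x => enc_bool (p x)) -> ptime i (fun x => enc_bool (~~ p x)).
Proof.
move=> pp; apply: ptime_ext (ptime_ifb pp (ptime_leaf _) (ptime_true _)) => x.
by case: (p x).
Qed.

(** * Unary numbers and indexing *)

Lemma enc_natE n : enc_nat n = enc_list (fun=> Leaf) (nseq n tt).
Proof. by elim: n => //= n; rewrite /enc_nat /= => ->. Qed.

Lemma enc_nat_size n : tree_size (enc_nat n) = n.*2.+1.
Proof. by elim: n => //= n; rewrite -/(enc_nat n) => ->; rewrite doubleS; lia. Qed.

Lemma ptime_drop X A (i : X -> tree) (e : A -> tree) n l :
  ptime i (fun x => enc_nat (n x)) -> ptime i (fun x => enc_list e (l x)) ->
  ptime i (fun x => enc_list e (drop (n x) (l x))).
Proof.
move=> pn pl.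
have dropE m (s : seq A) : foldr (fun _ => behead) s (nseq m tt) = drop m s.
  by elim: m => [|m /= ->]; rewrite ?drop0 // -drop1 drop_drop.
apply: (ptime_ext (fun x => congr1 (enc_list e) (dropE (n x) (l x)))).
apply: (@ptime_foldr _ _ _ i _ (fun=> Leaf) (fun x => nseq (n x) tt) l
  (fun _ _ => behead)) => //.
- by apply: ptime_ext pn => x; rewrite enc_natE.
- apply: (@ptime_path _ _ _ [:: true; false; true]) => z.
  by case: z.1.2.
exists (fun x => tree_size (enc_list e (l x))); first exact: ptime_bound pl.
move=> x l1 l2 _; rewrite (_ : l2 = nseq (size l2) tt); last first.
  by elim: l2 => //= -[] s {1}->.
rewrite dropE !enc_list_sizeE.
rewrite -{2}[l x](cat_take_drop (size l2)) big_cat /=; lia.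
Qed.

(** The head of an exhausted list evaluates to [Leaf], so the default value has to be encoded by
    [Leaf]. *)
Lemma ptime_nth X A (i : X -> tree) (e : A -> tree) d n l :
  e d = Leaf ->
  ptime i (fun x => enc_list e (l x)) -> ptime i (fun x => enc_nat (n x)) ->
  ptime i (fun x => e (nth d (l x) (n x))).
Proof.
move=> ed pl pn; apply: ptime_trans (ptime_drop pn pl) _.
apply: (@ptime_path _ _ _ [:: false]) => x.
rewrite -[n x in RHS]addn0 -nth_drop nth0.
by case: drop.
Qed.

(** Unary numbers are lists of units: [drop] subtracts them, and concatenation adds them. *)
Lemma ptime_sub X (i : X -> tree) m n :
  ptime i (fun x => enc_nat (m x)) -> ptime i (fun x => enc_nat (n x)) ->
  ptime i (fun x => enc_nat (m x - n x)).
Proof.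
move=> pm pn.
apply: (@ptime_ext _ _ (fun x =>
  enc_list (fun=> Leaf) (drop (n x) (nseq (m x) tt)))).
  by move=> x; rewrite drop_nseq enc_natE.
apply: ptime_drop => //.
by apply: ptime_ext pm => x; rewrite enc_natE.
Qed.

Lemma ptime_add X (i : X -> tree) m n :
  ptime i (fun x => enc_nat (m x)) -> ptime i (fun x => enc_nat (n x)) ->
  ptime i (fun x => enc_nat (m x + n x)).
Proof.
move=> pm pn.
apply: (@ptime_ext _ _ (fun x =>
  enc_list (fun=> Leaf) (nseq (m x) tt ++ nseq (n x) tt))).
  by move=> x; rewrite -nseqD enc_natE.
by apply: ptime_cat; [apply: ptime_ext pm | apply: ptime_ext pn] => x;
  rewrite enc_natE.
Qed.

Lemma ptime_sumn X (i : X -> tree) l :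
  ptime i (fun x => enc_list enc_nat (l x)) ->
  ptime i (fun x => enc_nat (sumn (l x))).
Proof.
move=> pl.
apply: (@ptime_ext _ _ (fun x =>
  enc_list (fun=> Leaf) (flatten [seq nseq n tt | n <- l x]))).
  move=> x; rewrite enc_natE; congr enc_list.
  by elim: (l x) => //= n s ->; rewrite nseqD.
apply: ptime_flatten; apply: ptime_ext pl => x.
by rewrite /enc_list -map_comp; congr enc_seq; apply: eq_map => n; exact: enc_natE.
Qed.

Lemma ptime_size X A (i : X -> tree) (e : A -> tree) l :
  ptime i (fun x => enc_list e (l x)) -> ptime i (fun x => enc_nat (size (l x))).
Proof.
move=> pl.
apply: (@ptime_ext _ _ (fun x =>
  enc_list (fun=> Leaf) [seq tt | _ <- l x])).
  by move=> x; rewrite enc_natE; congr enc_list; elim: (l x) => //= _ s ->.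
exact: ptime_map pl (ptime_leaf _).
Qed.

Lemma ptime_leq X (i : X -> tree) m n :
  ptime i (fun x => enc_nat (m x)) -> ptime i (fun x => enc_nat (n x)) ->
  ptime i (fun x => enc_bool (m x <= n x)).
Proof.
move=> pm pn.
apply: ptime_ext (ptime_if (ptime_sub pm pn) (ptime_leaf _) (ptime_true _)) => x.
by rewrite /leq; case: (m x - n x).
Qed.

Lemma ptime_eqn X (i : X -> tree) (m n : X -> nat) :
  ptime i (fun x => enc_nat (m x)) -> ptime i (fun x => enc_nat (n x)) ->
  ptime i (fun x => enc_bool (m x == n x)).
Proof.
move=> pm pn.
apply: ptime_ext (ptime_andb (ptime_leq pm pn) (ptime_leq pn pm)) => x.
by rewrite eqn_leq.
Qed.

Lemma ptime_iota X (i : X -> tree) n :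
  ptime i (fun x => enc_nat (n x)) ->
  ptime i (fun x => enc_list enc_nat (iota 0 (n x))).
Proof.
move=> pn.
have iotaE m :
    foldr (fun _ a => 0 :: [seq y.+1 | y <- a]) [::] (nseq m tt) = iota 0 m.
  by elim: m => //= m ->; rewrite (iotaDl 1 0).
apply: (ptime_ext (fun x => congr1 (enc_list enc_nat) (iotaE (n x)))).
apply: (@ptime_foldr _ _ _ i _ (fun=> Leaf) (fun x => nseq (n x) tt) (fun=> [::])
  (fun _ _ a => 0 :: [seq y.+1 | y <- a])).
- by apply: ptime_ext pn => x; rewrite enc_natE.
- exact: ptime_leaf.
- apply: ptime_cons; first exact: ptime_leaf.
  apply: (@ptime_map _ _ _ _ enc_nat enc_nat (fun z => z.1.2) (fun _ => S)).
    by pvar.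
  by apply: (ptime_cons (ptime_leaf _)); pvar.
have bn := ptime_bound pn.
exists (fun x => tree_size (enc_nat (n x)) * (tree_size (enc_nat (n x)) + 1) + 1).
  apply: pbound_add (pbound_const _ _); apply: pbound_mul => //.
  by apply: pbound_add (pbound_const _ _).
move=> x l1 l2 lE; rewrite (_ : l2 = nseq (size l2) tt); last first.
  by elim: l2 {lE} => //= -[] s {1}->.
have /(congr1 size) : nseq (n x) tt = l1 ++ l2 by [].
rewrite iotaE size_nseq size_cat => nE.
have := @enc_list_size_le _ enc_nat (iota 0 (size l2)) (tree_size (enc_nat (n x))).
rewrite size_iota => H; apply: leq_trans (H _) _; last first.
  by rewrite leq_add2r addn1 leq_mul // enc_nat_size; lia.
move=> y yl; rewrite !enc_nat_size.
suff : y < size l2 by lia.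
move: yl; elim: (size l2) => // m IH.
rewrite -addn1 iotaD add0n => H0; case: (List.in_app_or _ _ _ H0) => [/IH|[<-|[]]]; lia.
Qed.

Lemma ptime_take X A (i : X -> tree) (e : A -> tree) n l :
  ptime i (fun x => enc_nat (n x)) -> ptime i (fun x => enc_list e (l x)) ->
  ptime i (fun x => enc_list e (take (n x) (l x))).
Proof.
move=> pn pl.
apply: (@ptime_ext _ _ (fun x =>
  enc_list e (rev (drop (size (l x) - n x) (rev (l x)))))).
  move=> x; congr enc_list; rewrite drop_rev revK.
  have [|ln] := leqP (n x) (size (l x)); first by move/subKn->.
  by rewrite (_ : _ - n x = 0) ?subn0 ?take_size ?take_oversize //; lia.
apply: ptime_rev; apply: ptime_drop; last exact: ptime_rev.
apply: ptime_sub pn; exact: ptime_size pl.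
Qed.

(** Weakening: what is computable from the input remains so in a loop body, where the input is
    paired with an element. *)
Lemma ptime_fst X A (i o : X -> tree) (e : A -> tree) :
  ptime i o -> ptime (fun z : X * A => Node (i z.1) (e z.2)) (fun z => o z.1).
Proof. by move=> po; apply: (ptime_comp (h := fst) po); pvar. Qed.

Lemma ptime_mem X (i : X -> tree) (n : X -> nat) l :
  ptime i (fun x => enc_nat (n x)) -> ptime i (fun x => enc_list enc_nat (l x)) ->
  ptime i (fun x => enc_bool (n x \in l x)).
Proof.
move=> pn pl.
have pf : ptime i (fun x => enc_list enc_nat [seq y <- l x | n x == y]).
  apply: (@ptime_filter _ _ _ enc_nat l (fun x y => n x == y)) => //.
  by apply: ptime_eqn; [exact: (ptime_fst _ pn) | pvar].
apply: ptime_ext (ptime_if pf (ptime_true _) (ptime_leaf _)) => x.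
rewrite -has_pred1 has_filter (eq_filter (a2 := fun y => n x == y)).
  by case: filter.
by move=> y; rewrite eq_sym.
Qed.

(** * Subroutines *)

Fixpoint expr_vars (e : expr) : nat :=
  match e with
  | Var x => x.+1
  | Defs.Nil => 0
  | Defs.Cons e1 e2 => maxn (expr_vars e1) (expr_vars e2)
  | Hd e1 | Tl e1 => expr_vars e1
  end.

Fixpoint cmd_vars (c : cmd) : nat :=
  match c with
  | Skip => 0
  | Assign x e => maxn x.+1 (expr_vars e)
  | Seq c1 c2 => maxn (cmd_vars c1) (cmd_vars c2)
  | If e c1 c2 => maxn (expr_vars e) (maxn (cmd_vars c1) (cmd_vars c2))
  | While e c1 => maxn (expr_vars e) (cmd_vars c1)
  end.

Lemma eval_agree B e (s s' : store) :
  expr_vars e <= B -> (forall y, y < B -> s y = s' y) -> eval s e = eval s' e.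
Proof.
move=> eB ss; elim: e eB => [x||e1 IH1 e2 IH2|e1 IH|e1 IH] //= eB.
- exact: ss.
- by move: eB; rewrite geq_max => /andP[/IH1-> /IH2->].
- by rewrite IH.
- by rewrite IH.
Qed.

(** A program reads and writes only variables below [B], so its run can be replayed in the same time
    from any store that agrees there. This moves a run from the initial store into a store that
    holds the data of a caller. *)
Lemma exec_agree B c s t s1 s' :
  exec c s t s1 -> cmd_vars c <= B -> (forall y, y < B -> s y = s' y) ->
  exists s1', [/\ exec c s' t s1', forall y, y < B -> s1 y = s1' y
                & forall y, B <= y -> s1' y = s' y].
Proof.
move=> ex; elim: ex s' => {c s t s1} /=.
- by move=> s s' _ ss; exists s'; split=> //; exact: ExecSkip.
- move=> s x e s'; rewrite geq_max => /andP[xB eB] ss.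
  exists (update s' x (eval s' e)); split; first exact: ExecAssign.
    by move=> y yB; rewrite /update (eval_agree eB ss); case: ifP => // _; exact: ss.
  by move=> y yB; rewrite update_neq //; lia.
- move=> c1 c2 s s1 s2 t1 t2 _ IH1 _ IH2 s'.
  rewrite geq_max => /andP[/IH1{}IH1 /IH2{}IH2] /IH1[s1' [e1 a1 f1]].
  have [s2' [e2 a2 f2]] := IH2 _ a1.
  exists s2'; split=> //; first exact: ExecSeq e1 e2.
  by move=> y yB; rewrite f2 // f1.
- move=> e c1 c2 s s1 t es _ IH s'.
  rewrite !geq_max => /and3P[eB /IH{}IH _] ss; have [s1' [e1 a1 f1]] := IH _ ss.
  exists s1'; split=> //; apply: ExecIfTrue e1.
  by rewrite -(eval_agree eB ss).
- move=> e c1 c2 s s1 t es _ IH s'.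
  rewrite !geq_max => /and3P[eB _ /IH{}IH] ss; have [s1' [e1 a1 f1]] := IH _ ss.
  exists s1'; split=> //; apply: ExecIfFalse e1.
  by rewrite -(eval_agree eB ss).
- move=> e c s s1 s2 t1 t2 es _ IH1 _ IH2 s' ecB ss.
  have := ecB; rewrite geq_max => /andP[eB cB].
  have [s1' [e1 a1 f1]] := IH1 _ cB ss.
  have [s2' [e2 a2 f2]] := IH2 _ ecB a1.
  exists s2'; split=> //; last by move=> y yB; rewrite f2 // f1.
  by apply: ExecWhileTrue e1 e2; rewrite -(eval_agree eB ss).
move=> e c s es s'; rewrite geq_max => /andP[eB cB] ss.
exists s'; split=> //; apply: ExecWhileFalse.
by rewrite -(eval_agree eB ss).
Qed.

Fixpoint clear (n : nat) : cmd :=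
  if n is m.+1 then Seq (clear m) (Assign n Defs.Nil) else Skip.

Lemma clear_exec n s :
  exists s', [/\ exec (clear n) s (3 * n + 1) s',
    forall y, 0 < y <= n -> s' y = Leaf & forall y, (y == 0) || (n < y) -> s' y = s y].
Proof.
elim: n => [|n [s' [e z f]]] /=.
  by exists s; split=> //; [exact: ExecSkip | case].
exists (update s' n.+1 Leaf); split.
- rewrite (_ : 3 * n.+1 + 1 = (3 * n + 1 + (cost Defs.Nil).+1).+1) /=; last by lia.
  by apply: ExecSeq e _; exact: ExecAssign.
- move=> y yn; have [->|ny] := eqVneq y n.+1; first by upd.
  by rewrite update_neq // z //; lia.
- by move=> y yn; rewrite update_neq ?f //; lia.
Qed.

(* A subroutine expects all its variables but the first to be empty. *)
Lemma ptime_of_runs X (i o : X -> tree) c a d :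
  (forall x, exists2 t, runs c (i x) t (o x) & t <= a * tree_size (i x) ^ d + a) ->
  pbound i (fun x => tree_size (o x)) -> ptime i o.
Proof.
move=> H bo; pose B := cmd_vars c.
exists (Seq (clear B) c), B.+1, (fun x => a * tree_size (i x) ^ d + a + (3 * B + 2)).
split=> //.
  apply: pbound_add (pbound_const _ _); apply: pbound_add (pbound_const _ _).
  apply: pbound_mul (pbound_const _ _) _; apply: pbound_exp; exact: pbound_size.
move=> x s sx; have [t [s1 e1 o1] tle] := H x.
have [s0 [e0 z0 f0]] := clear_exec B s.
(* Taking [B.+1] instead of [B] includes the output variable 0 even if the program mentions no
   variable. *)
have [y yB|s2 [e2 a2 f2]] := @exec_agree B.+1 _ _ _ _ s0 e1 (leqnSn _).
  rewrite /init_store /update; case: eqP => [->|/eqP y0].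
    by rewrite f0 ?sx.
  by rewrite z0 //; lia.
exists (3 * B + 1 + t).+1, s2; split.
- exact: ExecSeq e0 e2.
- by lia.
- by rewrite -a2.
- by move=> y yB; rewrite f2 // f0 // yB orbT.
Qed.

Lemma runs_of_ptime X (i o : X -> tree) :
  ptime i o -> exists c a d, forall x,
    exists2 t, runs c (i x) t (o x) & t <= a * tree_size (i x) ^ d + a.
Proof.
(* Trees have positive size, so [m.+2 <= 3 * m] for a size [m]; hence the factor [3 ^ d]. *)
move=> [c [B [T [[d bT] _ H]]]]; exists c, (3 ^ d), d => x.
have [t [s [e le o1 _]]] := H x (init_store (i x)) (update_eq _ _ _).
exists t; first by exists s.
apply: leq_trans le (leq_trans (bT x) _); apply: leq_trans (leq_addr _ _).
rewrite -expnMn; have [->//|d_gt0] := posnP d; rewrite leq_exp2r //.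
by have := tree_size_gt0 (i x); lia.
Qed.

(** * The algorithm *)

Definition gadj (M : seq (seq bool)) (i j : nat) : bool :=
  nth false (nth [::] M i) j.

(** Ordered pairs are counted: for a simple graph and a list without duplicates this is twice the
    number of induced edges. *)
Definition score (M : seq (seq bool)) (T : seq nat) : nat :=
  sumn [seq sumn [seq (gadj M i j : nat) | j <- T] | i <- T].

Definition best (M : seq (seq bool)) (l : seq (seq nat)) : seq nat :=
  foldr (fun c a => if score M a <= score M c then c else a) [::] l.

(** The list [drop k T] is a counter: its length [size T - k] is the number of deletions, each of
    which leaves the highest score possible. *)
Definition trim (M : seq (seq bool)) (k : nat) (T : seq nat) : seq nat :=
  foldr (fun _ T => best M [seq [seq y <- T | v != y] | v <- T]) T (drop k T).

(* [(true, (i, i))] labels the vertex [i], and [(false, (i, j))] the copies of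
   the pair [(i, j)]. *)
Definition label : Type := (bool * (nat * nat))%type.

(** Vertex labels come first, so vertex [i] of the graph is also vertex [i] of the gadget. *)
Definition labels (n : nat) : seq label :=
  [seq (true, (i, i)) | i <- iota 0 n] ++
  flatten [seq flatten [seq [seq (false, (i, j)) | j <- iota 0 n] | i <- iota 0 n]
          | _ <- iota 0 n.+2].

Definition incident (M : seq (seq bool)) (i : nat) (e : nat * nat) : bool :=
  gadj M e.1 e.2 && ((i == e.1) || (i == e.2)).

Definition ladj (M : seq (seq bool)) (u v : label) : bool :=
  if u.1 then if v.1 then u.2.1 != v.2.1 else incident M u.2.1 v.2
  else v.1 && incident M v.2.1 u.2.

Lemma ladj_sym M : symmetric (ladj M).
Proof.
by move=> [[] [a b]] [[] [a' b']]; rewrite /ladj /= ?(eq_sym a').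
Qed.

Lemma ladj_irr M : irreflexive (ladj M).
Proof. by move=> [[] [a b]]; rewrite /ladj /= ?eqxx. Qed.

Definition vlabel (M : seq (seq bool)) (x : 'I_(size (labels (size M)))) : label :=
  nth (false, (0, 0)) (labels (size M)) x.

Definition gadget (M : seq (seq bool)) : sgraph :=
  @SGraph (size (labels (size M))) (fun x y => ladj M (vlabel x) (vlabel y))
    (fun x y => ladj_sym M _ _) (fun x => ladj_irr M _).

Section Algorithm.
Variable O : sgraph -> nat -> seq bool.

(** The number [k + (s - k)] is the maximum of [k] and the size [s] of the separator. Listing the
    graph vertices of the separator first keeps all of them; the vertices taken next replace its
    copies and pad the set. *)
Definition candidate (M : seq (seq bool)) (k K : nat) : seq nat :=
  let S := O (gadget M) K in
  let V := iota 0 (size M) in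
  trim M k (take (k + (sumn [seq nat_of_bool b | b <- S] - k))
    ([seq i <- V | nth false S i] ++ [seq i <- V | ~~ nth false S i])).

(** The budget of the analysis is one plus a number of labels, so it is at most one more than the
    number of all labels. *)
Definition solve (M : seq (seq bool)) (k : nat) : seq nat :=
  best M [seq candidate M k K | K <- iota 0 (size (labels (size M))).+2].

Definition enc_mat : seq (seq bool) -> tree := enc_list (enc_list enc_bool).

Definition enc_label (u : label) : tree :=
  Node (enc_bool u.1) (Node (enc_nat u.2.1) (enc_nat u.2.2)).

(** * Running time of the algorithm relative to the oracle *)

Lemma ptime_gadj X (i : X -> tree) M a b :
  ptime i (fun x => enc_mat (M x)) ->
  ptime i (fun x => enc_nat (a x)) -> ptime i (fun x => enc_nat (b x)) ->
  ptime i (fun x => enc_bool (gadj (M x) (a x) (b x))).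
Proof.
move=> pM pa pb; apply: ptime_nth pb => //.
exact: (@ptime_nth _ _ _ (enc_list enc_bool)).
Qed.

Lemma ptime_score X (i : X -> tree) M T :
  ptime i (fun x => enc_mat (M x)) ->
  ptime i (fun x => enc_list enc_nat (T x)) ->
  ptime i (fun x => enc_nat (score (M x) (T x))).
Proof.
move=> pM pT; apply: ptime_sumn.
apply: (@ptime_map _ _ _ _ enc_nat enc_nat T
  (fun x a => sumn [seq (gadj (M x) a j : nat) | j <- T x])) => //.
apply: ptime_sumn.
apply: (@ptime_map _ _ _ _ enc_nat enc_nat (fun z => T z.1)
  (fun z j => (gadj (M z.1) z.2 j : nat))); first exact: (ptime_fst _ pT).
apply: (@ptime_ext _ _ (fun z => enc_bool (gadj (M z.1.1) z.1.2 z.2))).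
  by move=> z; case: gadj.
apply: ptime_gadj; [exact: (ptime_fst _ (ptime_fst _ pM)) | pvar | pvar].
Qed.

Lemma ptime_fst2 X A C (i o : X -> tree) (e : A -> tree) (e' : C -> tree) :
  ptime i o ->
  ptime (fun z : X * A * C => Node (i z.1.1) (Node (e z.1.2) (e' z.2)))
    (fun z => o z.1.1).
Proof.
by move=> po; apply: (ptime_comp (h := fun z : X * A * C => z.1.1) po); pvar.
Qed.

Lemma best_in M l : best M l \in [::] :: l.
Proof.
rewrite inE; elim: l => //= c l IH; case: ifP => _; first by rewrite inE eqxx orbT.
by rewrite inE; case/orP: IH => ->; rewrite ?orbT.
Qed.

Lemma mem_In (T : eqType) (x : T) s : x \in s -> List.In x s.
Proof. by elim: s => //= y s IH; rewrite inE => /predU1P[->|/IH]; auto. Qed.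

Lemma ptime_best X (i : X -> tree) M l :
  ptime i (fun x => enc_mat (M x)) ->
  ptime i (fun x => enc_list (enc_list enc_nat) (l x)) ->
  ptime i (fun x => enc_list enc_nat (best (M x) (l x))).
Proof.
move=> pM pl.
apply: (@ptime_foldr _ _ _ i (enc_list enc_nat) (enc_list enc_nat) l (fun=> [::])
 (fun x c a => if score (M x) a <= score (M x) c then c else a)) => //.
- exact: ptime_leaf.
- apply: (@ptime_ext _ _ (fun z =>
    if score (M z.1.1) z.1.2 <= score (M z.1.1) z.2
    then enc_list enc_nat z.2 else enc_list enc_nat z.1.2)).
    by move=> z; case: ifP.
  apply: ptime_ifb; [|pvar|pvar].
  by apply: ptime_leq; apply: ptime_score; try exact: (ptime_fst2 _ _ pM); pvar.
exists (fun x => tree_size (enc_list (enc_list enc_nat) (l x))).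
  exact: ptime_bound pl.
move=> x l1 l2 lE; have := best_in (M x) l2; rewrite /best.
set b := foldr _ _ _; rewrite inE => /predU1P[->|bl].
  exact: tree_size_gt0.
apply: ltnW; apply: enc_list_size_in; apply: mem_In.
by rewrite lE mem_cat bl orbT.
Qed.

Lemma trim_step_size M (T T' : seq nat) :
  tree_size (enc_list enc_nat T) <= tree_size (enc_list enc_nat T') ->
  tree_size (enc_list enc_nat (best M [seq [seq y <- T | v != y] | v <- T])) <=
  tree_size (enc_list enc_nat T').
Proof.
move=> TT'; have := best_in M [seq [seq y <- T | v != y] | v <- T].
rewrite inE => /predU1P[->|/mapP[v _ ->]]; first exact: tree_size_gt0.
apply: leq_trans TT'; rewrite !enc_list_sizeE ltnS big_filter.
by rewrite [X in _ <= X](bigID (fun y => v != y)) leq_addr.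
Qed.

Lemma ptime_trim X (i : X -> tree) M k T :
  ptime i (fun x => enc_mat (M x)) -> ptime i (fun x => enc_nat (k x)) ->
  ptime i (fun x => enc_list enc_nat (T x)) ->
  ptime i (fun x => enc_list enc_nat (trim (M x) (k x) (T x))).
Proof.
move=> pM pk pT.
apply: (@ptime_foldr _ _ _ i (enc_list enc_nat) enc_nat
  (fun x => drop (k x) (T x)) T
  (fun x _ T => best (M x) [seq [seq y <- T | v != y] | v <- T])) => //.
- exact: ptime_drop.
- apply: ptime_best; first exact: (ptime_fst2 _ _ pM).
  apply: (@ptime_map _ _ _ _ enc_nat (enc_list enc_nat) (fun z => z.1.2)
    (fun z v => [seq y <- z.1.2 | v != y])); first by pvar.
  apply: (@ptime_filter _ _ _ enc_nat (fun z => z.1.1.2) (fun z y => z.2 != y)).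
    by pvar.
  by apply: ptime_negb; apply: ptime_eqn; pvar.
exists (fun x => tree_size (enc_list enc_nat (T x))); first exact: ptime_bound pT.
move=> x l1 l2 _; elim: l2 => //= _ l2 IH; exact: trim_step_size.
Qed.

Lemma ptime_labels X (i : X -> tree) n :
  ptime i (fun x => enc_nat (n x)) ->
  ptime i (fun x => enc_list enc_label (labels (n x))).
Proof.
move=> pn; have piota := ptime_iota pn.
have pairs : ptime i (fun x => enc_list enc_label
    (flatten [seq [seq (false, (a, b)) | b <- iota 0 (n x)] | a <- iota 0 (n x)])).
  apply: ptime_flatten.
  apply: (@ptime_map _ _ _ _ enc_nat (enc_list enc_label) _ (fun x a =>
    [seq (false, (a, b)) | b <- iota 0 (n x)])) => //.
  apply: (@ptime_map _ _ _ _ enc_nat enc_label _ (fun z b => (false, (z.2, b)))).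
    exact: (ptime_fst _ piota).
  by apply: (ptime_cons (ptime_leaf _)); apply: ptime_cons; pvar.
apply: ptime_cat.
  apply: (@ptime_map _ _ _ _ enc_nat enc_label _ (fun _ a => (true, (a, a)))) => //.
  apply: ptime_cons; first exact: ptime_true.
  by apply: ptime_cons; pvar.
apply: ptime_flatten.
apply: (@ptime_map _ _ _ _ enc_nat (enc_list enc_label) _ (fun x _ =>
  flatten [seq [seq (false, (a, b)) | b <- iota 0 (n x)] | a <- iota 0 (n x)])).
  apply: (@ptime_iota _ _ (fun x => (n x).+2)).
  by do 2!apply: (ptime_cons (ptime_leaf _)).
exact: (ptime_fst _ pairs).
Qed.

Lemma ptime_incident X (i : X -> tree) M a e :
  ptime i (fun x => enc_mat (M x)) ->
  ptime i (fun x => enc_nat (a x)) -> ptime i (fun x => enc_nat (e x).1) ->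
  ptime i (fun x => enc_nat (e x).2) ->
  ptime i (fun x => enc_bool (incident (M x) (a x) (e x))).
Proof.
move=> pM pa p1 p2; apply: ptime_andb; first exact: ptime_gadj.
by apply: ptime_orb; apply: ptime_eqn.
Qed.

Lemma ptime_ladj X (i : X -> tree) M u v :
  ptime i (fun x => enc_mat (M x)) ->
  ptime i (fun x => enc_label (u x)) -> ptime i (fun x => enc_label (v x)) ->
  ptime i (fun x => enc_bool (ladj (M x) (u x) (v x))).
Proof.
move=> pM pu pv.
have part w p o : ptime i (fun x => enc_label (w x)) ->
    (forall x, subtree_at p (enc_label (w x)) = o x) -> ptime i o.
  by move=> pw H; apply: ptime_trans pw _; apply: (ptime_path (p := p)).
have part1 w : ptime i (fun x => enc_label (w x)) ->
    ptime i (fun x => enc_bool (w x).1).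
  by move=> pw; apply: (part w [:: false]).
have part2 w : ptime i (fun x => enc_label (w x)) ->
    ptime i (fun x => enc_nat (w x).2.1).
  by move=> pw; apply: (part w [:: true; false]).
have part3 w : ptime i (fun x => enc_label (w x)) ->
    ptime i (fun x => enc_nat (w x).2.2).
  by move=> pw; apply: (part w [:: true; true]).
apply: (@ptime_ext _ _ (fun x => if (u x).1 then if (v x).1 then
    enc_bool ((u x).2.1 != (v x).2.1) else enc_bool (incident (M x) (u x).2.1 (v x).2)
  else enc_bool ((v x).1 && incident (M x) (v x).2.1 (u x).2))).
  by move=> x; rewrite /ladj; case: (u x).1 => //; case: (v x).1.
apply: ptime_ifb; first exact: part1.
  apply: ptime_ifb; first exact: part1.
    by apply: ptime_negb; apply: ptime_eqn; exact: part2.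
  by apply: ptime_incident; auto.
by apply: ptime_andb; [auto | apply: ptime_incident; auto].
Qed.

Lemma map_vlabel_enum M :
  [seq @vlabel M x | x <- enum 'I_(size (labels (size M)))] = labels (size M).
Proof.
apply: (@eq_from_nth _ (false, (0, 0))); rewrite size_map size_enum_ord // => j jL.
by rewrite (nth_map (Ordinal jL)) ?size_enum_ord // /vlabel nth_enum_ord.
Qed.

(** Iterating over labels in place of ordinals gives a form that the list programs can produce. *)
Lemma enc_gadgetE M :
  enc_graph (gadget M) =
  enc_mat [seq [seq ladj M u v | v <- labels (size M)] | u <- labels (size M)].
Proof.
have enumE := map_vlabel_enum M.
set L := map _ _ in enumE.
transitivity (enc_mat [seq [seq ladj M u v | v <- L] | u <- L]); last first.
  by rewrite enumE.
rewrite /enc_graph /enc_mat /enc_list /L -!map_comp.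
congr enc_seq; apply: eq_map => x /=.
by rewrite -!map_comp.
Qed.

Lemma ptime_gadget X (i : X -> tree) M :
  ptime i (fun x => enc_mat (M x)) -> ptime i (fun x => enc_graph (gadget (M x))).
Proof.
move=> pM; apply: (ptime_ext (fun x => esym (enc_gadgetE (M x)))).
have pL : ptime i (fun x => enc_list enc_label (labels (size (M x)))).
  apply: ptime_labels; exact: ptime_size pM.
apply: (@ptime_map _ _ _ _ enc_label (enc_list enc_bool) _ (fun x u =>
  [seq ladj (M x) u v | v <- labels (size (M x))])) => //.
apply: (@ptime_map _ _ _ _ enc_label enc_bool (fun z => labels (size (M z.1)))
  (fun z v => ladj (M z.1) z.2 v)); first exact: (ptime_fst _ pL).
by apply: ptime_ladj; [exact: (ptime_fst _ (ptime_fst _ pM)) | pvar | pvar].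
Qed.

Hypothesis ptime_O : ptime (fun p : sgraph * nat => enc_instance p.1 p.2)
  (fun p => enc_list enc_bool (O p.1 p.2)).

Lemma ptime_candidate X (i : X -> tree) M k K :
  ptime i (fun x => enc_mat (M x)) -> ptime i (fun x => enc_nat (k x)) ->
  ptime i (fun x => enc_nat (K x)) ->
  ptime i (fun x => enc_list enc_nat (candidate (M x) (k x) (K x))).
Proof.
move=> pM pk pK.
have pS : ptime i (fun x => enc_list enc_bool (O (gadget (M x)) (K x))).
  apply: (ptime_comp (h := fun x => (gadget (M x), K x)) ptime_O).
  by apply: ptime_cons => //; exact: ptime_gadget.
have piota : ptime i (fun x => enc_list enc_nat (iota 0 (size (M x)))).
  by apply: ptime_iota; exact: ptime_size pM.
have pbit : ptime (fun z : X * nat => Node (i z.1) (enc_nat z.2))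
    (fun z => enc_bool (nth false (O (gadget (M z.1)) (K z.1)) z.2)).
  by apply: ptime_nth => //; [exact: (ptime_fst _ pS) | pvar].
apply: ptime_trim => //; apply: ptime_take.
  apply: ptime_add => //; apply: ptime_sub => //; apply: ptime_sumn.
  apply: ptime_ext pS => x; rewrite /enc_list -map_comp; congr enc_seq.
  by apply: eq_map => -[].
apply: ptime_cat.
  by apply: (@ptime_filter _ _ _ _ _ (fun x j => nth false (O (gadget (M x)) (K x)) j)).
apply: (@ptime_filter _ _ _ _ _ (fun x j => ~~ nth false (O (gadget (M x)) (K x)) j)) => //.
exact: ptime_negb.
Qed.

Lemma ptime_solve X (i : X -> tree) M k :
  ptime i (fun x => enc_mat (M x)) -> ptime i (fun x => enc_nat (k x)) ->
  ptime i (fun x => enc_list enc_nat (solve (M x) (k x))).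
Proof.
move=> pM pk; apply: ptime_best => //.
apply: (@ptime_map _ _ _ _ enc_nat (enc_list enc_nat) _
  (fun x K => candidate (M x) (k x) K)).
  apply: (@ptime_iota _ _ (fun x => (size (labels (size (M x)))).+2)).
  do 2!apply: (ptime_cons (ptime_leaf _)).
  by apply: (@ptime_size _ _ _ enc_label); apply: ptime_labels; exact: ptime_size pM.
by apply: ptime_candidate; [exact: (ptime_fst _ pM) | exact: (ptime_fst _ pk) | pvar].
Qed.

End Algorithm.

(** * Greedy trimming *)

Section Greedy.
Variable M : seq (seq bool).
Hypothesis M_irr : forall i, gadj M i i = false.

Lemma scoreE T : score M T = \sum_(i <- T) \sum_(j <- T) (gadj M i j : nat).
Proof. by rewrite /score sumnE big_map; apply: eq_bigr => i _; rewrite sumnE big_map. Qed.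

Lemma best_ge l T : T \in l -> score M T <= score M (best M l).
Proof.
elim: l => //= T' l IH; rewrite inE => /predU1P[->|/IH]; case: ifP => // H.
- by rewrite leqNgt; move: H; case: ltnP => //; lia.
- by move/leq_trans; apply.
Qed.

(** Ties favour list elements over the accumulator, so the default [[::]], of score 0, does not
    survive. *)
Lemma best_mem l : l != [::] -> best M l \in l.
Proof.
elim: l => //= T l IH _; case: ifP => [_|H]; first by rewrite inE eqxx.
have [l0|/IH H'] := eqVneq l [::]; last by rewrite inE H' orbT.
by rewrite l0 /= in H.
Qed.

Lemma size_remove2 (T : seq nat) i j : uniq T -> i \in T -> j \in T -> i != j ->
  \sum_(v <- T) ((v != i) && (v != j) : nat) = size T - 2.
Proof.
move=> uT iT jT ij.
have -> : \sum_(v <- T) ((v != i) && (v != j) : nat) =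
    count (predC (predU (pred1 i) (pred1 j))) T.
  rewrite -sum1_count [RHS]big_mkcond; apply: eq_bigr => v _ /=.
  by rewrite negb_or; case: (v != i) (v != j) => [] [].
have := count_predC (predU (pred1 i) (pred1 j)) T.
have := count_predUI (pred1 i) (pred1 j) T.
rewrite !count_uniq_mem // iT jT (_ : count (predI _ _) T = 0); last first.
  apply/eqP; rewrite -leqn0 leqNgt -has_count; apply/hasPn => v _ /=.
  by case: eqP => // ->; rewrite (negPf ij).
by rewrite addn0 => -> <-; rewrite addKn.
Qed.

(** Double counting: a pair of adjacent vertices survives the removal of each vertex but its two
    endpoints, which are distinct as the diagonal of [M] is empty. *)
Lemma sum_score_remove T : uniq T ->
  \sum_(v <- T) score M [seq y <- T | v != y] = (size T - 2) * score M T.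
Proof.
move=> uT.
have -> : \sum_(v <- T) score M [seq y <- T | v != y] =
    \sum_(v <- T) \sum_(i <- T) \sum_(j <- T)
      ((v != i) && (v != j) : nat) * gadj M i j.
  apply: eq_bigr => v _; rewrite scoreE big_filter [LHS]big_mkcond /=.
  apply: eq_bigr => i _; case: (v != i); last by rewrite big1.
  rewrite big_filter [LHS]big_mkcond; apply: eq_bigr => j _ /=.
  by case: (v != j); rewrite ?mul1n.
rewrite exchange_big scoreE big_distrr /= !big_seq; apply: eq_bigr => i iT.
rewrite exchange_big big_distrr /= !big_seq; apply: eq_bigr => j jT.
rewrite -big_distrl /=.
have [<-|ij] := eqVneq i j; first by rewrite M_irr !muln0.
by rewrite size_remove2.
Qed.

Definition remove_worst (T : seq nat) : seq nat :=
  best M [seq [seq y <- T | v != y] | v <- T].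

(** The best of the [size T] removals is at least as good as the average one. *)
Lemma remove_worstP T : uniq T -> T != [::] ->
  [/\ uniq (remove_worst T), {subset remove_worst T <= T},
      size (remove_worst T) = (size T).-1
    & (size T - 2) * score M T <= size T * score M (remove_worst T)].
Proof.
move=> uT T0.
have : remove_worst T \in [seq [seq y <- T | v != y] | v <- T].
  by apply: best_mem; case: T T0 {uT}.
case/mapP=> v vT rE; split.
- by rewrite rE filter_uniq.
- by move=> y; rewrite rE mem_filter => /andP[].
- rewrite rE size_filter -[size T](count_predC (pred1 v)) count_uniq_mem // vT.
  by rewrite add1n /=; apply: eq_count => y /=; rewrite eq_sym.
rewrite -sum_score_remove //.
apply: (@leq_trans (\sum_(v <- T) score M (remove_worst T))).
  rewrite big_seq [X in _ <= X]big_seq; apply: leq_sum => w wT.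
  by apply: best_ge; apply: map_f.
by rewrite big_const_seq count_predT iter_addn_0 mulnC.
Qed.

(* A worst vertex of [T] has at most the average degree, so its removal keeps
   a fraction [(t - 2) / t] of the edges, where [t = size T]; the product of
   these fractions telescopes. *)
Lemma trimP k T : uniq T -> k <= size T ->
  [/\ uniq (trim M k T), {subset trim M k T <= T}, size (trim M k T) = k
    & score M T * (k * k.-1) <=
      score M (trim M k T) * (size T * (size T).-1)].
Proof.
move=> uT kT.
have -> : trim M k T = iter (size T - k) remove_worst T.
  by rewrite /trim -size_drop; elim: (drop k T) => //= _ s ->.
have := subnKC kT; move: (size T - k) => m; elim: m T uT {kT} => [|m IH] T uT Tk.
  by rewrite addn0 in Tk; split; rewrite //= ?Tk.
have [|uR RT sR scR] := remove_worstP uT.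
  by case: T Tk {uT} => //=; rewrite addnS.
have [|uI IR sI scI] := IH _ uR; first by rewrite sR -Tk; lia.
rewrite iterSr; split=> //; first by move=> y /IR /RT.
have sT : size T = (size (remove_worst T)).+1 by rewrite sR -Tk; lia.
move: scR scI; rewrite sT.
set a := score M T; set b := score M (remove_worst T).
set c := score M (iter _ _ _); set t := size _.
(* For [t <= 1] the factor [t.-1] is 0 and cannot be cancelled, but then [k <= 1] and the left side
   vanishes. *)
have [t_le|t_gt] := leqP t 1.
  rewrite (_ : k * k.-1 = 0) ?muln0 //.
  suff : k <= 1 by case: (k) => [|[]].
  by move: sT; rewrite -Tk -/t; lia.
rewrite (_ : t.+1 - 2 = t.-1); last by lia.
move=> scR scI; rewrite -(@leq_pmul2l t.-1); last by lia.
apply: (@leq_trans (t.+1 * (b * (k * k.-1)))).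
  by rewrite !mulnA leq_mul2r leq_mul2r scR !orbT.
apply: (@leq_trans (t.+1 * (c * (t * t.-1)))); first by rewrite leq_mul2l scI orbT.
by set p := t.-1; rewrite /=; nia.
Qed.

End Greedy.

(** * Separators of the gadget *)

Section Gadget.
Variable M : seq (seq bool).
Let n := size M.
Let V := iota 0 n.
Let L := labels n.
Let H := gadget M.

(** Ordered pairs are counted, as in [score] and in the gadget, where every ordered pair has its own
    copies. *)
Definition uncovered (U : pred nat) : nat :=
  \sum_(i <- V) \sum_(j <- V) (gadj M i j && ~~ (U i && U j) : nat).

(* With the vertices in [U] removed, these labels carry the big component. *)
Definition big_label (U : pred nat) (u : label) : bool :=
  if u.1 then ~~ U u.2.1 else gadj M u.2.1 u.2.2 && ~~ (U u.2.1 && U u.2.2).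

Lemma card_vlabel (P : pred label) :
  #|[set x : vertex H | P (@vlabel M x)]| = count P L.
Proof.
rewrite /L -map_vlabel_enum.
rewrite count_map cardsE cardE -size_filter enumT; congr size.
Qed.

Lemma count_labels (P : pred label) :
  count P L = count (fun i => P (true, (i, i))) V +
    n.+2 * \sum_(i <- V) \sum_(j <- V) (P (false, (i, j)) : nat).
Proof.
rewrite /L /labels count_cat count_map; congr (_ + _).
rewrite count_flatten -map_comp sumnE big_map big_const_seq count_predT size_iota.
rewrite iter_addn_0 mulnC; congr (_ * _).
rewrite /= count_flatten -map_comp sumnE big_map; apply: eq_bigr => i _ /=.
by rewrite count_map -sum1_count big_mkcond.
Qed.

Lemma count_big_label U :
  count (big_label U) L = count (predC U) V + n.+2 * uncovered U.
Proof. by rewrite count_labels. Qed.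

Lemma uncovered_le (U U' : pred nat) :
  {in V, subpred U U'} -> uncovered U' <= uncovered U.
Proof.
move=> UU'; rewrite /uncovered big_seq [X in _ <= X]big_seq.
apply: leq_sum => i iV; rewrite big_seq [X in _ <= X]big_seq.
apply: leq_sum => j jV; case: (gadj M i j) => //=.
case Ui: (U i); case Uj: (U j); rewrite /= ?leq_b1 //.
by rewrite (UU' i iV Ui) (UU' j jV Uj).
Qed.

Lemma score_filter T : uniq T -> {subset T <= V} ->
  score M T =
  \sum_(i <- V) \sum_(j <- V) [&& gadj M i j, i \in T & j \in T].
Proof.
move=> uT TV.
have TE : perm_eq T [seq y <- V | y \in T].
  apply: uniq_perm => //; first by rewrite filter_uniq // iota_uniq.
  by move=> y; rewrite mem_filter; have := TV y; case: (y \in T) => // ->.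
have sumT (F : nat -> nat) : \sum_(i <- T) F i = \sum_(i <- V) (i \in T) * F i.
  rewrite (perm_big _ TE) big_filter big_mkcond; apply: eq_bigr => i _ /=.
  by case: (i \in T); rewrite ?mul1n.
rewrite scoreE sumT; apply: eq_bigr => i _; rewrite sumT big_distrr.
by apply: eq_bigr => j _; case: (i \in T) (j \in T) (gadj M i j) => [] [] [].
Qed.

Lemma uncovered_score T : uniq T -> {subset T <= V} ->
  uncovered [in T] + score M T = score M V.
Proof.
move=> uT TV; rewrite (score_filter uT TV) scoreE /uncovered -big_split.
apply: eq_bigr => i _; rewrite -big_split; apply: eq_bigr => j _ /=.
by case: (i \in T) (j \in T) (gadj M i j) => [] [] [].
Qed.

Lemma vlabel_lt (x : vertex H) : x < n ->
  @vlabel M x = (true, (nat_of_ord x, nat_of_ord x)).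
Proof.
move=> xn; rewrite /vlabel /labels nth_cat size_map size_iota xn.
by rewrite (nth_map 0) ?size_iota // nth_iota.
Qed.

Lemma vlabel_vertex (x : vertex H) : (@vlabel M x).1 ->
  (nat_of_ord x < n) * (@vlabel M x = (true, (nat_of_ord x, nat_of_ord x))).
Proof.
have [xn|xn] := ltnP x n; first by rewrite vlabel_lt.
rewrite /vlabel /labels nth_cat size_map size_iota -/n ifN -?leqNgt //.
set l := (X in nth _ X _); have : x - n < size l.
  have LE : size L = n + size l by rewrite size_cat size_map size_iota.
  have : nat_of_ord x < size L by apply: ltn_ord.
  by rewrite LE; move: xn; set y := nat_of_ord x; lia.
move/(mem_nth (false, (0, 0))) => /flatten_mapP[_ _ /flatten_mapP[a _ /mapP[b _ ->]]].
by [].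
Qed.

Lemma vlabel_pair (x : vertex H) : ~~ (@vlabel M x).1 ->
  ((@vlabel M x).2.1 \in V) * ((@vlabel M x).2.2 \in V).
Proof.
have : @vlabel M x \in L by apply: mem_nth.
rewrite mem_cat => /orP[/mapP[i _ ->] //|].
by move=> /flatten_mapP[_ _ /flatten_mapP[a aV /mapP[b bV ->]]].
Qed.

Lemma vertex_of_nat i : i < n -> {x : vertex H | nat_of_ord x = i}.
Proof.
move=> i_n; have iL : i < size L by rewrite size_cat size_map size_iota; lia.
by exists (Ordinal iL).
Qed.

Lemma min_separator_le (G : sgraph) k (S : {set vertex G}) :
  is_separator k S -> min_separator G k <= #|S|.
Proof.
move=> sS; rewrite /min_separator; case: arg_minnP => [|A _]; last exact.
by apply/forallP => x; rewrite !inE.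
Qed.

(** Once the vertices in [U] are removed, every remaining edge joins two big labels. A component
    thus either consists of big labels or is a single vertex, for which [0 < K] leaves room. *)
Lemma separator_of_vertices (U : pred nat) K :
  0 < K -> count (big_label U) L <= K -> min_separator H K <= count U V.
Proof.
move=> K_gt0 bK.
pose S := [set x : vertex H | (@vlabel M x).1 && U (@vlabel M x).2.1].
have sS : #|S| = count U V.
  rewrite (card_vlabel (fun u => u.1 && U u.2.1)) count_labels /=.
  rewrite [X in _ * X]big1 ?muln0 ?addn0 // => i _.
  by rewrite big1.
rewrite -sS; apply: min_separator_le.
have edge x y : induced (~: S) x y ->
    big_label U (@vlabel M x) && big_label U (@vlabel M y).
  rewrite /induced /= !inE /ladj /big_label /incident.
  case: (@vlabel M x) => [[] [a b]]; case: (@vlabel M y) => [[] [a' b']] //=.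
  - by case/and3P=> -> ->.
  - by case/and3P=> Ua -> /orP[]/eqP<-; rewrite Ua (negPf Ua) ?andbF.
  - by case/and3P=> Ua -> /orP[]/eqP<-; rewrite Ua (negPf Ua) ?andbF.
apply/forall_inP => x _.
have [bx|bx] := boolP (big_label U (@vlabel M x)).
  apply: leq_trans bK; rewrite -card_vlabel; apply: subset_leq_card.
  apply/subsetP => y; rewrite !inE => /andP[_ /connectP[p]].
  elim: p x bx => [|z p IH] x bx /=; first by move=> _ ->.
  by case/andP=> /edge/andP[_ bz] /IH; apply.
apply: leq_trans K_gt0; rewrite -(cards1 x); apply: subset_leq_card.
apply/subsetP => y; rewrite !inE => /andP[_ /connectP[[|z p]]] /=.
  by move=> _ ->.
by case/andP=> /edge/andP[]; rewrite (negPf bx).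
Qed.

(* Every vertex of the gadget that [S] contains beyond the vertices [U] of the
   graph takes only one vertex away from the big component. *)
Lemma separator_bound K (S : {set vertex H}) (U : pred nat) :
  (forall x : vertex H, x < n -> U x = (x \in S)) ->
  is_separator K S -> has (predC U) V ->
  count (big_label U) L + count U V <= K + #|S|.
Proof.
move=> US sepS /hasP[i0]; rewrite mem_iota add0n => /andP[_ i0n] /= Ui0.
pose C := [set x : vertex H | big_label U (@vlabel M x)].
pose D := [set x : vertex H | (@vlabel M x).1 && U (@vlabel M x).2.1].
have sD : #|D| = count U V.
  rewrite (card_vlabel (fun u => u.1 && U u.2.1)) count_labels /=.
  rewrite [X in _ * X]big1 ?muln0 ?addn0 // => i _.
  by rewrite big1.
rewrite -card_vlabel -/C -sD -(cardsID S C).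
have DS : D \subset S.
  by apply/subsetP => x; rewrite inE => /andP[/vlabel_vertex[xn ->]]; rewrite /= US.
have CD : [disjoint C :&: S & D].
  rewrite -setI_eq0; apply/eqP/setP => x; rewrite !inE /big_label.
  by case: (@vlabel M x) => [[] [a b]] //=; case: (U a); rewrite /= ?andbF.
have CSD : #|C :&: S| + #|D| <= #|S|.
  rewrite -cardsUI (disjoint_setI0 CD) cards0 addn0.
  by apply: subset_leq_card; rewrite subUset subsetIr.
suff CS : #|C :\: S| <= K by rewrite addnAC addnC; apply: leq_add.
(* All surviving big labels lie in the component of [x0]: other vertices are joined to it by the
   clique, and a copy is joined to an endpoint outside [U]. *)
have [x0 x0i] := vertex_of_nat i0n.
have x0S : x0 \notin S by rewrite -US x0i.
have sep0 := forall_inP sepS x0.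
apply: leq_trans (sep0 _); last by rewrite inE.
apply: subset_leq_card; apply/subsetP => y; rewrite !inE => /andP[yS by_].
rewrite yS /=.
have vertex_conn z : z \notin S -> z < n -> connect (induced (~: S)) x0 z.
  move=> zS zn; have [->|zx] := eqVneq z x0; first exact: connect0.
  apply: connect1; rewrite /induced /= !inE x0S zS /= /ladj !vlabel_lt ?x0i //=.
  by apply: contra_neq zx => zi; apply: val_inj; rewrite /= -zi.
have [y1|y1] := boolP (@vlabel M y).1.
  by apply: vertex_conn => //; have [] := vlabel_vertex y1.
have [aV bV] := vlabel_pair y1.
move: by_; rewrite /big_label (negPf y1) negb_and => /andP[gab Uab].
have [a [an Ua inc]] : exists a, [/\ a < n, ~~ U a & incident M a (@vlabel M y).2].
  case/orP: Uab => Ua; [exists (@vlabel M y).2.1 | exists (@vlabel M y).2.2].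
    by split=> //; [move: aV; rewrite mem_iota | rewrite /incident gab eqxx].
  by split=> //; [move: bV; rewrite mem_iota | rewrite /incident gab eqxx orbT].
have [xa xaE] := vertex_of_nat an.
have xaS : xa \notin S by rewrite -US xaE.
apply: connect_trans (vertex_conn xa xaS _) (connect1 _); first by rewrite xaE.
rewrite /induced /= !inE xaS yS /= /ladj vlabel_lt ?xaE //=.
by rewrite (negPf y1).
Qed.

End Gadget.

(** * Correctness *)

Definition adj_mat (G : sgraph) : seq (seq bool) :=
  [seq [seq adj x y | y <- enum 'I_(Defs.order G)] | x <- enum 'I_(Defs.order G)].

Section Graph.
Variable G : sgraph.
Let n := Defs.order G.
Let M := adj_mat G.

Lemma enc_graphE : enc_graph G = enc_mat M.
Proof.
rewrite /enc_graph /enc_mat /enc_list /M /adj_mat -map_comp; congr enc_seq.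
by apply: eq_map => x; rewrite [RHS]/= -map_comp.
Qed.

Lemma size_adj_mat : size M = n.
Proof. by rewrite size_map size_enum_ord. Qed.

Lemma gadj_adj (x y : 'I_n) : gadj M x y = adj x y.
Proof.
rewrite /gadj (nth_map x) ?size_enum_ord //.
by rewrite (nth_map x) ?size_enum_ord // !nth_ord_enum.
Qed.

Lemma gadj_out i j : (n <= i) || (n <= j) -> gadj M i j = false.
Proof.
move=> ij; rewrite /gadj.
have [ni|i_n] := leqP n i.
  by rewrite [nth [::] _ _]nth_default ?size_adj_mat // nth_nil.
rewrite (nth_map (Ordinal i_n)) ?size_enum_ord // nth_default //.
by rewrite size_map size_enum_ord; move: ij; rewrite leqNgt i_n.
Qed.

Lemma gadj_irr i : gadj M i i = false.
Proof.
have [ni|i_n] := leqP n i; first by rewrite gadj_out ?ni.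
by rewrite (gadj_adj (Ordinal i_n) (Ordinal i_n)) adj_irr.
Qed.

Lemma score_nb_edges (T : seq nat) (A : {set vertex G}) :
  uniq T -> {subset T <= iota 0 n} ->
  (forall x : 'I_n, (nat_of_ord x \in T) = (x \in A)) ->
  score M T = (nb_edges A).*2.
Proof.
move=> uT TV TA; rewrite score_filter ?size_adj_mat //.
rewrite -[n in iota 0 n]subn0 -/(index_iota 0 n) big_mkord.
pose F (x y : 'I_n) : nat := [&& x < y, x \in A, y \in A & adj x y].
have nbE : nb_edges A = \sum_(x < n) \sum_(y < n) F x y.
  rewrite pair_bigA /= /nb_edges -sum1_card big_mkcond /=.
  by apply: eq_bigr => p _; rewrite inE /F; case: ifP.
(* Swapping the indices in one of the two sums makes them cover both orders of each pair. *)
rewrite -addnn {1}nbE nbE [X in _ = _ + X]exchange_big -big_split /=.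
apply: eq_bigr => x _; rewrite big_mkord -big_split /=.
apply: eq_bigr => y _; rewrite /F gadj_adj !TA (adj_sym y x).
case: (ltngtP x y) => [_|_|/val_inj->]; last by rewrite adj_irr.
- by case: (x \in A) (y \in A) (adj x y) => [] [] [].
- by case: (x \in A) (y \in A) (adj x y) => [] [] [].
Qed.

End Graph.

(** * The vertex set obtained from a separator *)

Section Candidate.
Variables (G : sgraph) (k : nat) (O : sgraph -> nat -> seq bool).
Let n := Defs.order G.
Let M := adj_mat G.
Let V := iota 0 n.
Hypothesis kn : k <= n.

(** The set that [candidate] trims when the oracle answers [S]. *)
Definition initial (S : seq bool) : seq nat :=
  take (k + (sumn [seq nat_of_bool b | b <- S] - k))
    ([seq i <- V | nth false S i] ++ [seq i <- V | ~~ nth false S i]).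

Lemma count_mem_subset T : uniq T -> {subset T <= V} -> count [in T] V = size T.
Proof.
move=> uT TV; rewrite -size_filter; apply/perm_size/uniq_perm => //.
  by rewrite filter_uniq // iota_uniq.
by move=> i; rewrite mem_filter; have := TV i; case: (i \in T) => // ->.
Qed.

Lemma count_enum (A : {set vertex G}) :
  count (fun i => i \in [seq nat_of_ord x | x <- enum A]) V = #|A|.
Proof.
rewrite count_mem_subset ?size_map -?cardE //.
  by rewrite map_inj_uniq ?enum_uniq //; exact: val_inj.
by move=> _ /mapP[x _ ->]; rewrite mem_iota /= ltn_ord.
Qed.

Lemma initialP S (s := sumn [seq nat_of_bool b | b <- S]) :
  [/\ uniq (initial S), {subset initial S <= V}
    & size (initial S) = minn n (maxn k s)].
Proof.
have permV : perm_eq ([seq i <- V | nth false S i] ++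
    [seq i <- V | ~~ nth false S i]) V by rewrite (perm_filterC (nth false S)).
split.
- by apply: take_uniq; rewrite (perm_uniq permV) iota_uniq.
- by move=> i /mem_take; rewrite (perm_mem permV).
- rewrite size_take_min (perm_size permV) size_iota -maxnE -/s.
  by rewrite minnC.
Qed.

Lemma candidateP K (T := candidate O M k K) :
  [/\ uniq T, {subset T <= V} & size T = k].
Proof.
rewrite /T /candidate size_adj_mat.
have [u s z] := initialP (O (gadget M) K).
have [|uT sT zT _] := @trimP M (@gadj_irr G) k (initial (O (gadget M) K)) u.
  by rewrite z leq_min kn leq_maxl.
by split=> //; move=> y /sT /s.
Qed.

Lemma solve_candidate : exists K, solve O M k = candidate O M k K.
Proof.
have : solve O M k \in [seq candidate O M k K | K <- iota 0 (size (labels (size M))).+2].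
  exact: best_mem.
by case/mapP=> K _ ->; exists K.
Qed.

(* The budget [K] is the size of the big component that remains when [A] is
   removed from the gadget, plus one so that the isolated vertices fit too when
   that component is empty. *)
Lemma initial_score (A : {set vertex G})
    (U := fun i => i \in [seq nat_of_ord x | x <- enum A])
    (K := (count (big_label M U) (labels (size M))).+1)
    (S : {set vertex (gadget M)}) :
  #|A| = k -> is_separator K S ->
  (nb_edges A).*2 <=
    score M (initial [seq x \in S | x <- enum 'I_(Defs.order (gadget M))]).
Proof.
move=> Ak sepS.
set bits := map _ _.
have [uI sI zI] := initialP bits.
set T := initial bits in uI sI zI *.
have sS : sumn [seq nat_of_bool b | b <- bits] = #|S|.
  rewrite /bits sumnE 2!big_map big_enum /= -sum1_card [RHS]big_mkcond.
  by apply: eq_bigr => x _; case: (x \in S).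
rewrite sS in zI.
pose TA := [seq nat_of_ord x | x <- enum A].
have uTA : uniq TA by rewrite map_inj_uniq ?enum_uniq //; exact: val_inj.
have TAV : {subset TA <= V}.
  by move=> _ /mapP[x _ ->]; rewrite mem_iota /= ltn_ord.
have scA : score M TA = (nb_edges A).*2.
  apply: score_nb_edges => // x.
  by rewrite mem_map ?mem_enum //; exact: val_inj.
have VM : V = iota 0 (size M) by rewrite size_adj_mat.
have uncT := @uncovered_score M T uI; rewrite -VM in uncT.
have uncA := @uncovered_score M TA uTA; rewrite -VM in uncA.
move/(_ sI) in uncT; move/(_ TAV) in uncA.
rewrite -scA; suff : uncovered M [in T] <= uncovered M [in TA] by lia.
(* If the bound reaches [n], then [T] is the whole vertex set and leaves no pair uncovered. *)
have [nS|Sn] := leqP n (maxn k #|S|).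
  have TV : T =i V.
    have [] := uniq_min_size uI sI; last by move=> _ H; exact: H.
    by rewrite zI (minn_idPl nS) size_iota.
  rewrite [uncovered M [in T]]big_seq big1 // => i; rewrite -VM => iV.
  by rewrite big_seq big1 // => j jV; rewrite /= !TV iV jV andbF.
rewrite (minn_idPr (ltnW Sn)) in zI.
have bitE (x : vertex (gadget M)) : nth false bits x = (x \in S).
  by rewrite (nth_map x) ?size_enum_ord // nth_ord_enum.
have n_le : n <= size bits.
  by rewrite size_map size_enum_ord /= size_cat size_map size_iota size_adj_mat leq_addr.
have cU : count (nth false bits) V <= #|S|.
  rewrite -(count_map _ id) map_nth_iota0 // -sS sumn_count.
  by rewrite -[X in _ <= count _ X](cat_take_drop n) count_cat leq_addr.
have cA : count U V = k.
  by rewrite count_enum.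
have hasU : has (predC (nth false bits)) V.
  by rewrite has_predC all_count size_iota; apply: contraTN Sn => /eqP; lia.
have := @separator_bound M K S (nth false bits) (fun x _ => bitE x) sepS.
rewrite -VM => /(_ hasU); rewrite /K !count_big_label -VM size_adj_mat -/n.
have := count_predC U V; have := count_predC (nth false bits) V.
rewrite size_iota cA.
(* At most [#|S|] vertices of the graph lie in [S], so the truncation in [initial] keeps them
   all. *)
have UT : uncovered M [in T] <= uncovered M (nth false bits).
  apply: uncovered_le => i; rewrite -VM => iV /= bi.
  rewrite /T /initial sS -maxnE take_cat size_filter.
  have iT0 : i \in [seq i <- V | nth false bits i] by rewrite mem_filter bi.
  by rewrite ltnNge (leq_trans cU (leq_maxr _ _)) /= mem_cat iT0.
move: UT; rewrite -/TA.
set a := uncovered M [in T]; set b := uncovered M [in TA].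
set c := uncovered M _; rewrite -/b => ac.
have : n.+2 * a <= n.+2 * c by rewrite leq_mul2l ac orbT.
set na := n.+2 * a; set nb := n.+2 * b; set nc := n.+2 * c => Hac eU eA eK.
(* If [T] left more pairs uncovered than [TA], there would be a surplus of at least [n.+2] copies.
   The separator bound allows a surplus of at most [#|S| + 1 - k], and [#|S| < n]. *)
rewrite leqNgt; apply/negP => ba.
have : n.+2 * b.+1 <= na by rewrite leq_mul2l ba orbT.
rewrite mulnS -/nb => Hba.
have Sn' : #|S| < n by apply: leq_ltn_trans (leq_maxr _ _) Sn.
move: Hac eU eA eK Hba Sn'; move: #|S| (count (nth false bits) V) (count (predC U) V).
move: (count (predC (nth false bits)) V) na nb nc n (k) => *; lia.
Qed.

End Candidate.

(** * The approximation ratio *)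

Lemma nb_edges_small (G : sgraph) (A : {set vertex G}) : #|A| <= 1 -> nb_edges A = 0.
Proof.
move/card_le1_eqP=> A1; apply/eqP; rewrite cards_eq0; apply/eqP/setP => -[x y].
rewrite !inE /=; apply/negP => /and4P[xy xA yA _].
by move: xy; rewrite (A1 x y xA yA) ltnn.
Qed.

(** One has [t - 1 <= f * k - 1 <= 2 * f * (k - 1)], where the last inequality uses [2 <= k]: this
    is the source of the factor 2. *)
Lemma trim_ratio (R : realType) (f : R) (k t q b : nat) :
  1 < k -> (1 <= f)%R -> (t%:R <= f * k%:R)%R ->
  q * (k * k.-1) <= b * (t * t.-1) -> (q%:R <= 2 * f ^+ 2 * b%:R)%R.
Proof.
case: k => [|[|k]] // _ f1 tfk; rewrite -(ler_nat R) !natrM /= => qb.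
have k0 : (0 <= k%:R :> R)%R by [].
have t1 : (t.-1%:R <= f * k.+2%:R - 1 :> R)%R.
  case: t tfk {qb} => [|t] tfk /=; last first.
    by rewrite lerBrDr -natr1 in tfk *.
  by rewrite subr_ge0 (le_trans f1) // ler_peMr ?ler1n // (le_trans ler01).
have tt : (t%:R * t.-1%:R <= (f * k.+2%:R) * (2 * f * k.+1%:R) :> R)%R.
  apply: ler_pM => //; apply: le_trans t1 _.
  by rewrite -!natr1; nra.
have kk : (0 < k.+2%:R * k.+1%:R :> R)%R by rewrite mulr_gt0 ?ltr0n.
rewrite -(ler_pM2r kk); apply: le_trans qb _.
apply: le_trans (ler_wpM2l (ler0n _ b) tt) _.
by rewrite le_eqVlt; apply/orP; left; apply/eqP; ring.
Qed.

(** In the graph with one vertex and for [k = 0], the only separator is the whole vertex set, so the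
    minimum is 1 and is attained by the output. *)
Lemma approx_factor_ge1 (R : realType) (f : R) :
  (forall G k, exists S, @approx_separator R f G k S) -> (1 <= f)%R.
Proof.
move=> H.
pose G := @SGraph 1 (fun _ _ => false) (fun _ _ => erefl) (fun _ => erefl).
have sepT (S : {set vertex G}) : is_separator 0 S -> S = [set: vertex G].
  move/forall_inP => sepS; apply/setP => x; rewrite [RHS]inE.
  apply: contraT => xS; have := sepS x; rewrite inE => /(_ xS).
  by rewrite leqn0 cards_eq0 => /eqP/setP/(_ x); rewrite !inE xS connect0.
have [S [sepS]] := H G 0.
rewrite (sepT _ sepS) /min_separator; case: arg_minnP => [|A sepA _].
  by apply/forall_inP => x; rewrite !inE.
by rewrite (sepT _ sepA) cardsT card_ord mulr1.
Qed.

(** * From separators to dense subgraphs *)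

Section Reduction.
Variables (R : realType) (f : R) (alg : forall (G : sgraph), nat -> {set vertex G}).
Hypothesis alg_approx : forall G k, approx_separator f k (@alg G k).

Definition alg_bits (G : sgraph) (k : nat) : seq bool :=
  [seq x \in alg G k | x <- enum 'I_(Defs.order G)].

Definition densest (G : sgraph) (k : nat) : {set vertex G} :=
  [set x : 'I_(Defs.order G) | nat_of_ord x \in solve alg_bits (adj_mat G) k].

Lemma densest_approx G k : k <= Defs.order G ->
  approx_densest (2%:R * f ^+ 2)%R k (densest G k).
Proof.
move=> kn; set n := Defs.order G; set M := adj_mat G.
have f1 : (1 <= f)%R.
  by apply: approx_factor_ge1 => G' k'; exists (alg G' k'); exact: alg_approx.
have [uT sT zT] : [/\ uniq (solve alg_bits M k),
    {subset solve alg_bits M k <= iota 0 n} & size (solve alg_bits M k) = k].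
  by have [K ->] := solve_candidate G k alg_bits; apply: candidateP.
have scT : score M (solve alg_bits M k) = (nb_edges (densest G k)).*2.
  by apply: score_nb_edges => // x; rewrite inE.
have cardT : #|densest G k| = k.
  rewrite -[RHS]zT cardE -(size_map (@nat_of_ord n)); apply/perm_size/uniq_perm => //.
    by rewrite map_inj_uniq ?enum_uniq //; exact: val_inj.
  move=> i; apply/mapP/idP => [[x]|iT]; first by rewrite mem_enum inE => xT ->.
  have := sT i iT; rewrite mem_iota => /= i_n.
  by exists (Ordinal i_n) => //; rewrite mem_enum inE.
split=> //.
have [|A Ak maxA] := @eq_bigmax_cond _ [pred A : {set vertex G} | #|A| == k] (@nb_edges G).
  by apply/card_gt0P; exists (densest G k); rewrite inE cardT eqxx.
rewrite [max_edges G k]maxA; have {}Ak : #|A| = k by apply/eqP.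
rewrite ler_pdivrMl; last by rewrite mulr_gt0 // exprn_gt0 // (lt_le_trans ltr01).
(* At most one vertex induces no edge, and the ratio [k * k.-1] would be 0. *)
have [k1|k1] := leqP k 1.
  by rewrite nb_edges_small ?Ak // !mulr_ge0 // (le_trans ler01).
pose U := fun i => i \in [seq nat_of_ord x | x <- enum A].
pose K := (count (big_label M U) (labels (size M))).+1.
have [sepS] := alg_approx (gadget M) K.
set S := alg (gadget M) K => appS.
have minS : min_separator (gadget M) K <= k.
  have := @separator_of_vertices M U K isT (leqnSn _).
  by rewrite size_adj_mat count_enum Ak.
have Sfk : (#|S|%:R <= f * k%:R)%R.
  apply: le_trans appS _; rewrite ler_wpM2l ?ler_nat //.
  exact: le_trans ler01 f1.
have scA := initial_score kn Ak sepS.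
have [uI sI zI] := initialP G k (alg_bits (gadget M) K).
have kI : k <= size (initial G k (alg_bits (gadget M) K)).
  by rewrite zI leq_min kn leq_maxl.
have [_ _ _ scI] := trimP (@gadj_irr G) uI kI.
have scB : score M (trim M k (initial G k (alg_bits (gadget M) K))) <=
    score M (solve alg_bits M k).
  have -> : trim M k (initial G k (alg_bits (gadget M) K)) =
      candidate alg_bits M k K by rewrite /candidate size_adj_mat.
  apply: best_ge; apply: map_f.
  by rewrite mem_iota /= add0n /K !ltnS count_size.
(* The set before trimming has at most [f * k] elements, since [#|S|] is bounded by [f * k] and
   [1 <= f]. *)
apply: (@trim_ratio _ _ k (minn n (maxn k #|S|))) => //.
  apply: le_trans (_ : ((maxn k #|S|)%:R <= _)%R).
    by rewrite ler_nat geq_minr.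
  have [_|_] := leqP #|S| k => //.
  by rewrite ler_peMl.
rewrite zI in scI; rewrite scT in scB.
rewrite (_ : sumn _ = #|S|) in scI; last first.
  rewrite sumnE 2!big_map big_enum /= -sum1_card [RHS]big_mkcond.
  by apply: eq_bigr => x _; case: (x \in S).
(* Scores are twice the numbers of edges, so both sides are doubled. *)
rewrite -leq_double !doubleMl.
apply: leq_trans (leq_trans scI _); last by rewrite leq_mul2r scB orbT.
by rewrite leq_mul2r scA orbT.
Qed.

Hypothesis ptime_alg : ptime (fun p : sgraph * nat => enc_instance p.1 p.2)
  (fun p => enc_set (alg p.1 p.2)).

Lemma ptime_densest : ptime (fun p : sgraph * nat => enc_instance p.1 p.2)
  (fun p => enc_set (densest p.1 p.2)).
Proof.
have bitsE G k : enc_list enc_bool (alg_bits G k) = enc_set (alg G k).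
  by rewrite /enc_list /alg_bits -map_comp.
have pM : ptime (fun p : sgraph * nat => enc_instance p.1 p.2)
    (fun p => enc_mat (adj_mat p.1)).
  by apply: (@ptime_path _ _ _ [:: false]) => p; rewrite /= enc_graphE.
have pk : ptime (fun p : sgraph * nat => enc_instance p.1 p.2)
    (fun p => enc_nat p.2) by apply: (@ptime_path _ _ _ [:: true]).
have pO : ptime (fun p : sgraph * nat => enc_instance p.1 p.2)
    (fun p => enc_list enc_bool (alg_bits p.1 p.2)).
  by apply: ptime_ext ptime_alg => p; rewrite bitsE.
have pS := ptime_solve pO pM pk.
apply: (@ptime_ext _ _ (fun p => enc_list enc_bool
  [seq i \in solve alg_bits (adj_mat p.1) p.2 | i <- iota 0 (size (adj_mat p.1))])).
  move=> [G k] /=; rewrite size_adj_mat -val_enum_ord /enc_list -2!map_comp.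
  by congr enc_seq; apply: eq_map => x /=; rewrite inE.
apply: (@ptime_map _ _ _ _ enc_nat enc_bool _
  (fun p i => i \in solve alg_bits (adj_mat p.1) p.2)).
  by apply: ptime_iota; exact: ptime_size pM.
by apply: ptime_mem; [pvar | exact: (ptime_fst _ pS)].
Qed.

End Reduction.

Theorem theorem2 (R : realType) (f : R) :
  (exists c : cmd, separator_approx_algorithm f c) ->
  exists c : cmd, densest_approx_algorithm (2%:R * f ^+ 2)%R c.
Proof.
move=> [c [a [d H]]].
pose good G k (S : {set vertex G}) := (exists2 t, runs c (enc_instance G k) t (enc_set S)
  & t <= a * tree_size (enc_instance G k) ^ d + a) /\ approx_separator f k S.
(* Choice turns the outputs of [c] into a function; keeping the run in [good] ensures that [c]
   computes it. *)
have ex_good G k : {S | @good G k S}.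
  by apply: cid; have [t [S [? ? ?]]] := H G k I; exists S; split=> //; exists t.
pose alg G k := sval (ex_good G k).
have alg_approx G k : approx_separator f k (alg G k).
  exact: (svalP (ex_good G k)).2.
have ptime_alg : ptime (fun p : sgraph * nat => enc_instance p.1 p.2)
    (fun p => enc_set (alg p.1 p.2)).
  apply: (@ptime_of_runs _ _ _ c a d) => [[G k]|]; first exact: (svalP (ex_good G k)).1.
  (* A bit has size at most 3 and its list node adds 1, so the output takes at most 4 per vertex
     plus 1; the vertices are fewer than the size of the instance. *)
  apply: pbound_le (pbound_add (pbound_mul (pbound_size _) (pbound_const _ 4))
    (pbound_const _ 1)) => -[G k] /=.
  have := @enc_list_size_le _ enc_bool [seq x \in alg G k | x <- enum 'I_(Defs.order G)] 3.
  rewrite size_map size_enum_ord /enc_list -map_comp => le.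
  apply: leq_trans (le _) _; first by case.
  have := enc_list_size_length (enc_list enc_bool) (adj_mat G).
  by rewrite size_adj_mat -/(enc_mat _) -enc_graphE; lia.
have [c' [a' [d' H']]] := runs_of_ptime (ptime_densest ptime_alg).
exists c', a', d' => G k kG; have [t rt tle] := H' (G, k).
by exists t, (densest alg G k); split=> //; exact: densest_approx.
Qed.
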